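(* If $\sigma$ is an oriented affine $k$-cell in $\mathbb R^n$, there is a unique differential $k$-chain $\widetilde\sigma\in\hat{\mathcal B}_k^1$ such that $$\int_{\widetilde\sigma}\omega=\int_\sigma\omega$$ for all $\omega\in\mathcal B_k^1$, where the right hand integral is the Riemann integral.
   Context: An affine $n$-cell in $\mathbb R^n$ is the intersection of finitely many affine half spaces in $\mathbb R^n$ whose closure is compact; an affine $k$-cell in $\mathbb R^n$ is an affine $k$-cell in a $k$-dimensional affine subspace of $\mathbb R^n$. It can be open or closed. Fix the standard inner product on $\mathbb R^n$, extended to $k$-vectors by $\langle u_1\wedge\dots\wedge u_k,v_1\wedge\dots\wedge v_k\rangle=\det(\langle u_i,v_j\rangle)$. A simple $k$-vector has mass $\|\alpha\|=\sqrt{\langle\alpha,\alpha\rangle}$; a general one has mass $\|\alpha\|=\inf\{\sum\|\alpha_j\|:\alpha=\sum\alpha_j,\ \alpha_j \text{ simple}\}$. $\mathcal A_k$ is the space of Dirac $k$-chains: finite formal sums $\sum(p_i;\alpha_i)$, $p_i\in\mathbb R^n$, $\alpha_i\in\Lambda_k(\mathbb R^n)$ (finitely supported functions $\mathbb R^n\to\Lambda_k(\mathbb R^n)$). With $\Delta_u(p;\alpha)=(p+u;\alpha)-(p;\alpha)$, the $B^1$ norm is $\|A\|_{B^1}=\inf\{\sum_i\|\alpha_i\|+\sum_j\|u_j\|\|\beta_j\|: A=\sum_i(p_i;\alpha_i)+\sum_j\Delta_{u_j}(q_j;\beta_j)\}$ (finite sums); $\hat{\mathcal B}_k^1$ is the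 completion of $\mathcal A_k$ in this norm. A $k$-form is a linear functional $\omega$ on $\mathcal A_k$; $\mathcal B_k^1$ is the space of $k$-forms with $\sup\{|\omega(p;\alpha)|:\|\alpha\|=1\}<\infty$ and $\sup\{|\omega(\Delta_u(p;\alpha))|:\|u\|\|\alpha\|=1\}<\infty$ (bounded Lipschitz $k$-forms). For $J\in\hat{\mathcal B}_k^1$, $\omega\in\mathcal B_k^1$: $\int_J\omega=\lim\omega(A_i)$ for Dirac chains $A_i\to J$ in the $B^1$ norm. *)

(* Defs.v *)
(* Library: MathComp and MathComp-Analysis. *)
From HB Require Import structures.
From mathcomp Require Import all_boot all_order all_algebra.
From mathcomp Require Import generic_quotient perm.
From mathcomp Require Import all_classical all_reals.
From mathcomp Require Import topology normedtype sequences.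

Set Implicit Arguments.
Unset Strict Implicit.
Unset Printing Implicit Defensive.

Import Order.TTheory GRing.Theory Num.Theory.
Import numFieldNormedType.Exports.

Local Open Scope classical_set_scope.
Local Open Scope ring_scope.
Local Open Scope quotient_scope.

Section EuclideanVectors.
Variables (R : realType) (n : nat).

Definition dot (u v : 'rV[R]_n) : R := \sum_i u 0 i * v 0 i.

(* The library norm on ['rV[R]_n] is the sup norm. *)
Definition enorm (u : 'rV[R]_n) : R := Num.sqrt (dot u u).

Lemma enorm_ge0 u : 0 <= enorm u. Proof. exact: sqrtr_ge0. Qed.

Lemma enormZ c u : enorm (c *: u) = `|c| * enorm u.
Proof.
rewrite /enorm /dot -[`|c|]sqrtr_sqr -sqrtrM ?sqr_ge0// mulr_sumr.
by congr Num.sqrt; apply: eq_bigr => i _; rewrite !mxE expr2 mulrACA.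
Qed.

Lemma enorm_eq0 u : enorm u = 0 -> u = 0.
Proof.
move=> /eqP; rewrite sqrtr_eq0 => le0; apply/rowP => i; rewrite mxE.
have ge0 j : true -> 0 <= u 0 j * u 0 j by rewrite -expr2 sqr_ge0.
have : dot u u == 0 by rewrite eq_le le0 sumr_ge0.
by rewrite psumr_eq0// => /allP/(_ i (mem_index_enum _)); rewrite -expr2 sqrf_eq0 => /eqP.
Qed.

End EuclideanVectors.

Definition kindex (n k : nat) : finType :=
  {f : {ffun 'I_k -> 'I_n} |
    [forall i : 'I_k, forall j : 'I_k, (i < j) ==> (f i < f j)]%N}.

Section KVectors.
Variables (R : realType) (n k : nat).

(* Coordinates in the basis e_(f 0) /\ ... /\ e_(f (k-1)) of the k-th exterior
   power of R^n, with f strictly increasing. *)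
Definition kvector := {ffun kindex n k -> R^o}.

HB.instance Definition _ := GRing.Lmodule.on kvector.

(* The wedge product of the rows of B: its coordinates are the k x k minors. *)
Definition wedge (B : 'M[R]_(k, n)) : kvector :=
  [ffun f : kindex n k => \det (colsub (val f) B)].

(* On wedge products this is the Gram determinant, see [inner_wedge]. *)
Definition inner (a b : kvector) : R := \sum_f (a f : R) * (b f : R).

(* The scalar c only matters for k = 0, where [wedge B] is always 1. *)
Definition simple (a : kvector) : Prop :=
  exists (c : R) (B : 'M[R]_(k, n)), a = c *: wedge B.

Definition simple_mass (a : kvector) : R := Num.sqrt (inner a a).

Definition simple_decomp (a : kvector) : set (seq kvector) :=
  [set s | (forall b, b \in s -> simple b) /\ a = \sum_(b <- s) b].

(* This agrees with [simple_mass] on simple k-vectors, see [mass_simple]. *)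
Definition mass (a : kvector) : R :=
  inf [set \sum_(b <- s) simple_mass b | s in simple_decomp a].

End KVectors.

Section DiracChains.
Variables (R : realType) (n k : nat).
Local Notation V := 'rV[R]_n.
Local Notation L := (kvector R n k).

Definition finsupp : {pred V -> L} :=
  [pred A | `[< finite_set [set p | A p != 0] >]].

Lemma finsuppP A : reflect (finite_set [set p | A p != 0]) (A \in finsupp).
Proof. exact: asboolP. Qed.

Lemma finsupp_submod : submod_closed finsupp.
Proof.
split=> [|c A B /finsuppP fA /finsuppP fB]; apply/finsuppP.
  by apply: (sub_finite_set _ (finite_set0 V)) => p /= /negP; apply; apply/eqP.
apply: (@sub_finite_set _ _ ([set p | A p != 0] `|` [set p | B p != 0])); last first.
  by rewrite finite_setU.
move=> p /=; apply: contraPP => /not_orP[/negP]; rewrite negbK => /eqP A0.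
move=> /negP; rewrite negbK => /eqP B0; apply/negP; rewrite negbK.
by rewrite [X in X == _](_ : _ = c *: A p + B p)// A0 B0 scaler0 addr0.
Qed.

HB.instance Definition _ :=
  GRing.isSubmodClosed.Build R (V -> L) finsupp finsupp_submod.

Record dirac_chain := DiracChain {
  dirac_fun :> V -> L;
  dirac_funP : dirac_fun \in finsupp }.

HB.instance Definition _ := [isSub for dirac_fun].
HB.instance Definition _ := [Choice of dirac_chain by <:].
HB.instance Definition _ := [SubChoice_isSubLmodule of dirac_chain by <:].

Lemma dirac_subproof (p : V) (a : L) :
  (fun q => if q == p then a else 0) \in finsupp.
Proof.
apply/finsuppP; apply: (sub_finite_set _ (finite_set1 p)) => q /=.
by case: (q =P p) => // _; rewrite eqxx.
Qed.

Definition dirac (p : V) (a : L) : dirac_chain := DiracChain (dirac_subproof p a).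

Definition translate_diff (u p : V) (a : L) : dirac_chain :=
  dirac (p + u) a - dirac p a.

Definition B1_decomp (A : dirac_chain) : set (seq (V * L) * seq (V * V * L)) :=
  [set d | A = \sum_(x <- d.1) dirac x.1 x.2
             + \sum_(y <- d.2) translate_diff y.1.1 y.1.2 y.2].

Definition B1_cost (d : seq (V * L) * seq (V * V * L)) : R :=
  \sum_(x <- d.1) mass x.2 + \sum_(y <- d.2) enorm y.1.1 * mass y.2.

Definition B1norm (A : dirac_chain) : R := inf [set B1_cost d | d in B1_decomp A].

Definition bounded_lipschitz (w : {scalar dirac_chain}) : Prop :=
  has_ubound [set r : R | exists p a, mass a = 1 /\ r = `|w (dirac p a)|] /\
  has_ubound [set r : R | exists u p a,
    enorm u * mass a = 1 /\ r = `|w (translate_diff u p a)|].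

End DiracChains.

Section KVectorTheory.
Variables (R : realType) (n k : nat).
Implicit Types a b : kvector R n k.

Lemma kindex_inj (f : kindex n k) : injective (val f).
Proof.
move=> i j fij; apply/val_inj; case: f fij => f /= /forallP fP fij.
case: (ltngtP i j) => // lt.
  by have /forallP/(_ j) := fP i; rewrite lt fij ltnn.
by have /forallP/(_ i) := fP j; rewrite lt fij ltnn.
Qed.

Lemma kindex_sorted (f : kindex n k) :
  sorted ltn [seq val (val f i) | i <- enum 'I_k].
Proof.
case: f => f /= /forallP fP; rewrite sorted_map.
apply: (@sub_sorted _ (relpre val ltn)).
  by move=> i j /= ij; have /forallP/(_ j)/implyP := fP i; apply.
by rewrite -sorted_map val_enum_ord iota_ltn_sorted.
Qed.

Lemma kindex_eq (f g : kindex n k) :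
  (forall i, exists j, val f i = val g j) -> f = g.
Proof.
move=> fg; apply/val_inj/ffunP => i.
have ef : [seq val (val f i) | i <- enum 'I_k] =
          [seq val (val g i) | i <- enum 'I_k].
  apply: (irr_sorted_eq ltn_trans ltnn (kindex_sorted f) (kindex_sorted g)).
  have su (h : kindex n k) : uniq [seq val (val h i) | i <- enum 'I_k].
    by rewrite map_inj_uniq ?enum_uniq// => x y /val_inj/kindex_inj.
  have [] := @uniq_min_size _ _ _ (su f) _ (_ : size [seq val (val g i) | i <- enum 'I_k] <= _)%N.
  - move=> x /mapP[j _ ->]; have [l ->] := fg j.
    by apply/mapP; exists l; rewrite ?mem_enum.
  - by rewrite !size_map.
  - by [].
have nthE (h : kindex n k) :
    nth 0%N [seq val (val h j) | j <- enum 'I_k] i = val (val h i).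
  by rewrite (nth_map i) ?size_enum_ord// nth_ord_enum.
by apply/val_inj; rewrite -[LHS]nthE ef nthE.
Qed.

Lemma kindex_perm (g : {ffun 'I_k -> 'I_n}) : injective g ->
  exists (f : kindex n k) (s : 'S_k), forall i, g i = val f (s i).
Proof.
move=> gI; pose r (i : 'I_k) := #|[pred j | (g j < g i)%N]|.
have rlt i : (r i < k)%N.
  rewrite -[X in (_ < X)%N](card_ord k); apply: proper_card.
  by apply/properP; split; [exact/fintype.subsetP|exists i; rewrite ?inE// ltnn].
have rmono i j : (g i < g j)%N -> (r i < r j)%N.
  move=> ij; apply: proper_card; apply/properP; split.
    by apply/fintype.subsetP => l; rewrite !inE => /ltn_trans; apply.
  by exists i; rewrite ?inE// ltnn.
have rI : injective (fun i => Ordinal (rlt i)).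
  move=> i j [rij]; apply/gI/val_inj; case: (ltngtP (g i) (g j)) => // /rmono.
    by rewrite rij ltnn.
  by rewrite rij ltnn.
pose s := perm rI.
have sE i : s i = r i :> nat by rewrite permE.
pose f := [ffun i => g ((s^-1)%g i)].
have fP : [forall i : 'I_k, forall j : 'I_k, (i < j) ==> (f i < f j)]%N.
  apply/forallP => i; apply/forallP => j; apply/implyP; rewrite !ffunE.
  rewrite -{1}[i](permKV s) -{1}[j](permKV s) !sE.
  case: (ltngtP (g ((s^-1)%g i)) (g ((s^-1)%g j))) => //.
    by move=> /rmono/ltnW; rewrite leqNgt => /negP.
  by move=> /val_inj/gI ->; rewrite ltnn.
by exists (Sub f fP), s => i; rewrite SubK ffunE permK.
Qed.

Lemma kindex_perm_inj (f f' : kindex n k) (s s' : 'S_k) :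
  (forall i, val f (s i) = val f' (s' i)) -> f = f' /\ s = s'.
Proof.
move=> e; have ff' : f = f'.
  apply: kindex_eq => i; exists (s' ((s^-1)%g i)).
  by rewrite -e permKV.
split=> //; apply/permP => i; apply: (@kindex_inj f).
by rewrite e ff'.
Qed.

(* Cauchy-Binet. *)
Lemma inner_wedge (U W : 'M[R]_(k, n)) :
  inner (wedge U) (wedge W) = \det (\matrix_(i, j) dot (row i U) (row j W)).
Proof.
pose D (g : {ffun 'I_k -> 'I_n}) : R := (\prod_i U i (g i)) * \det (colsub g W).
have -> : \det (\matrix_(i, j) dot (row i U) (row j W)) = \sum_g D g.
  transitivity (\sum_(s : 'S_k) \sum_(g : {ffun 'I_k -> 'I_n})
      (-1) ^+ s * ((\prod_i U i (g i)) * \prod_i W (s i) (g i))).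
    apply: eq_bigr => s _; rewrite -mulr_sumr; congr (_ * _).
    transitivity (\prod_i \sum_j U i j * W (s i) j).
      by apply: eq_bigr => i _; rewrite mxE; apply: eq_bigr => j _; rewrite !mxE.
    by rewrite bigA_distr_bigA/=; apply: eq_bigr => g _; rewrite big_split.
  rewrite exchange_big/=; apply: eq_bigr => g _; rewrite /D -det_tr mulr_sumr.
  apply: eq_bigr => s _; rewrite mulrCA; congr (_ * (_ * _)).
  by apply: eq_bigr => i _; rewrite !mxE.
pose h (p : kindex n k * 'S_k) := [ffun i => val p.1 (p.2 i)].
have hI : injective h.
  move=> [f s] [f' s'] /ffunP e.
  have [i|-> -> //] := @kindex_perm_inj f f' s s'.
  by have := e i; rewrite !ffunE.
have -> : \sum_g D g = \sum_(g in h @: [set: kindex n k * 'S_k]%SET) D g.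
  rewrite [RHS]big_mkcond/=; apply: eq_bigr => g _; case: ifPn => // /negP gh.
  have : ~ injective g.
    move=> /kindex_perm[f [s gfs]]; apply: gh; apply/imsetP; exists (f, s); rewrite ?inE//.
    by apply/ffunP => i; rewrite ffunE gfs.
  rewrite /D => gNI; rewrite -det_tr.
  have /injectivePn[i [j ij gij]] : ~~ injectiveb g by apply/negP => /injectiveP.
  by rewrite (determinant_alternate ij) ?mulr0// => l; rewrite !mxE gij.
rewrite big_imset/=; last by move=> x y _ _; exact: hI.
rewrite (eq_bigl xpredT) => [|x]; last by rewrite inE.
rewrite -(pair_bigA _ (fun f s => D (h (f, s)))) /=; apply: eq_bigr => f _.
rewrite !ffunE mulr_suml; apply: eq_bigr => s _; rewrite /D /h/=.
have -> : colsub [ffun i => val f (s i)] W = col_perm s (colsub (val f) W).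
  by apply/matrixP => i j; rewrite !mxE ffunE.
rewrite col_permE det_mulmx det_perm odd_permV.
rewrite -mulrA [X in _ = _ * X]mulrC mulrCA; congr (_ * (_ * _)).
by apply: eq_bigr => i _; rewrite !mxE ffunE.
Qed.

Lemma wedge_delta (f : kindex n k) :
  wedge (\matrix_(i, j) (j == val f i)%:R : 'M[R]_(k, n)) =
  [ffun g => (g == f)%:R].
Proof.
apply/ffunP => g; rewrite !ffunE; case: eqP => [->|gf].
  rewrite -[RHS](det1 R k); congr (\det _); apply/matrixP => i j.
  by rewrite !mxE (inj_eq (@kindex_inj f)) eq_sym.
have [i iP] : exists i, forall j, val f i <> val g j.
  apply: contrapT => /forallNP h; apply: gf; apply/esym/kindex_eq => i.
  by have /existsNP[j /contrapT] := h i; exists j.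
rewrite (expand_det_row _ i) big1// => j _; rewrite !mxE.
by case: eqP => [/esym/iP//|_]; rewrite mul0r.
Qed.

Lemma simpleZ c a : simple a -> simple (c *: a).
Proof. by move=> [d [B ->]]; exists (c * d), B; rewrite scalerA. Qed.

Lemma simple_decomp_neq0 a : simple_decomp a !=set0.
Proof.
exists [seq (a f : R) *: wedge (\matrix_(i, j) (j == val f i)%:R : 'M[R]_(k, n))
       | f <- enum (kindex n k)]; split=> [b /mapP[f _ ->]|].
  by apply: simpleZ; exists 1; eexists; rewrite scale1r.
rewrite big_map big_enum/=; apply/ffunP => g; rewrite sum_ffunE (bigD1 g)//=.
rewrite wedge_delta !ffunE eqxx big1 => [|f /negPf fg].
  by rewrite addr0 [RHS]mulr1.
by rewrite wedge_delta !ffunE eq_sym fg [LHS]mulr0.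
Qed.

Lemma inner_ge0 a : 0 <= inner a a.
Proof. by apply: sumr_ge0 => f _; rewrite -expr2 sqr_ge0. Qed.

Lemma inner_eq0 a : inner a a = 0 -> a = 0.
Proof.
move=> /eqP; rewrite psumr_eq0 => [|f _]; last by rewrite -expr2 sqr_ge0.
move=> /allP a0; apply/ffunP => f; rewrite ffunE.
by have := a0 f (mem_index_enum _); rewrite /= -expr2 sqrf_eq0 => /eqP.
Qed.

Lemma innerDD a b :
  inner (a + b) (a + b) = inner a a + inner a b *+ 2 + inner b b.
Proof.
rewrite /inner -sumrMnl -!big_split/=; apply: eq_bigr => f _; rewrite !ffunE.
by rewrite -!expr2 sqrrD.
Qed.

Lemma inner_scale c d a b : inner (c *: a) (d *: b) = c * d * inner a b.
Proof.
rewrite /inner mulr_sumr; apply: eq_bigr => f _; rewrite !ffunE.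
by rewrite [_ *: a f]/(c * _) [_ *: b f]/(d * _) mulrACA.
Qed.

Lemma simple_mass_ge0 a : 0 <= simple_mass a. Proof. exact: sqrtr_ge0. Qed.

Lemma simple_massZ c a : simple_mass (c *: a) = `|c| * simple_mass a.
Proof.
by rewrite /simple_mass inner_scale -expr2 sqrtrM ?sqr_ge0// sqrtr_sqr.
Qed.

Lemma simple_mass_sqr a : simple_mass a ^+ 2 = inner a a.
Proof. by rewrite sqr_sqrtr// inner_ge0. Qed.

Lemma simple_mass0 : simple_mass (0 : kvector R n k) = 0.
Proof. by rewrite -(scale0r 0) simple_massZ normr0 mul0r. Qed.

Lemma simple_mass_eq0 a : simple_mass a = 0 -> a = 0.
Proof.
by move=> a0; apply: inner_eq0; rewrite -simple_mass_sqr a0 expr0n.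
Qed.

Lemma inner_le a b : inner a b <= simple_mass a * simple_mass b.
Proof.
have := simple_mass_ge0 b; rewrite le_eqVlt => /predU1P[/esym b0|b0].
  rewrite b0 mulr0 (simple_mass_eq0 b0) -(scale0r b) -[a]scale1r.
  by rewrite inner_scale mulr0 mul0r.
have := simple_mass_ge0 a; rewrite le_eqVlt => /predU1P[/esym a0|a0].
  rewrite a0 mul0r (simple_mass_eq0 a0) -(scale0r a) -[b]scale1r.
  by rewrite inner_scale mul0r mul0r.
have := inner_ge0 (simple_mass b *: a + - simple_mass a *: b).
rewrite innerDD !inner_scale -!simple_mass_sqr.
set x := simple_mass a in a0 *; set y := simple_mass b in b0 *.
have -> : y * y * x ^+ 2 + (y * - x * inner a b) *+ 2 + - x * - x * y ^+ 2
        = (x * y) *+ 2 * (x * y - inner a b).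
  rewrite mulrNN mulrN mulNr mulNrn -!expr2 -!exprMn [y * x]mulrC.
  by rewrite mulrnAl mulrBr mulrnBl -expr2 [LHS]addrAC [in RHS]mulr2n.
by rewrite pmulr_rge0 ?subr_ge0// pmulrn_lgt0// mulr_gt0.
Qed.

Lemma simple_massD a b : simple_mass (a + b) <= simple_mass a + simple_mass b.
Proof.
rewrite -(@ler_pXn2r _ 2) ?nnegrE ?addr_ge0 ?simple_mass_ge0//.
rewrite sqrrD !simple_mass_sqr innerDD lerD2r lerD2l ler_pMn2r//.
exact: inner_le.
Qed.

Lemma mass_lbound a :
  lbound [set \sum_(b <- s) simple_mass b | s in simple_decomp a] (simple_mass a).
Proof.
move=> _ [s [_ ->] <-]; elim/big_rec2: _ => [|b x y _ xy].
  by rewrite simple_mass0.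
by apply: le_trans (simple_massD _ _) _; rewrite lerD2l.
Qed.

Lemma mass_has_inf a :
  has_inf [set \sum_(b <- s) simple_mass b | s in simple_decomp a].
Proof.
split; last by exists (simple_mass a); exact: mass_lbound.
by have [s hs] := simple_decomp_neq0 a; exists (\sum_(b <- s) simple_mass b), s.
Qed.

Lemma mass_le a s : simple_decomp a s -> mass a <= \sum_(b <- s) simple_mass b.
Proof. by move=> h; apply: ge_inf; [case: (mass_has_inf a)|exists s]. Qed.

Lemma simple_mass_le_mass a : simple_mass a <= mass a.
Proof.
by apply: lb_le_inf; [case: (mass_has_inf a)|exact: mass_lbound].
Qed.

Lemma mass_ge0 a : 0 <= mass a.
Proof. exact: le_trans (simple_mass_ge0 a) (simple_mass_le_mass a). Qed.

Lemma mass_simple a : simple a -> mass a = simple_mass a.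
Proof.
move=> sa; apply/le_anti; rewrite simple_mass_le_mass andbT.
have /mass_le : simple_decomp a [:: a].
  by split=> [b|]; rewrite ?inE ?big_seq1// => /eqP ->.
by rewrite big_seq1.
Qed.

Lemma mass_eq0 a : mass a = 0 -> a = 0.
Proof.
move=> a0; apply/simple_mass_eq0/le_anti.
by rewrite simple_mass_ge0 -a0 simple_mass_le_mass.
Qed.

Lemma massZ c a : mass (c *: a) = `|c| * mass a.
Proof.
have le d b : mass (d *: b) <= `|d| * mass b.
  have [->|d0] := eqVneq d 0.
    rewrite scale0r normr0 mul0r mass_simple ?simple_mass0//.
    by exists 0, 0; rewrite scale0r.
  rewrite mulrC -ler_pdivrMr ?normr_gt0//; apply: lb_le_inf.
    by case: (mass_has_inf b).
  move=> _ [s [ss ->] <-]; rewrite ler_pdivrMr ?normr_gt0//.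
  have /mass_le : simple_decomp (d *: \sum_(b <- s) b) [seq d *: b | b <- s].
    split=> [e /mapP[x xs ->]|]; first exact/simpleZ/ss.
    by rewrite scaler_sumr big_map.
  rewrite big_map mulr_suml => /le_trans; apply.
  by rewrite le_eqVlt; apply/orP; left; apply/eqP/eq_bigr => x _;
    rewrite simple_massZ mulrC.
apply/le_anti; rewrite le/=; have [->|c0] := eqVneq c 0.
  by rewrite normr0 mul0r mass_ge0.
rewrite -ler_pdivlMl ?normr_gt0// -normfV -[a in mass a <= _]scale1r.
by rewrite -(mulVf c0) -scalerA le.
Qed.

End KVectorTheory.

Section B1Theory.
Variables (R : realType) (n k : nat).
Local Notation chain := (dirac_chain R n k).
Implicit Types A B C : chain.

Lemma dirac_funE (A B : chain) p : (A + B) p = A p + B p. Proof. by []. Qed.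

Lemma dirac_fun_sum I (s : seq I) (F : I -> chain) p :
  (\sum_(i <- s) F i) p = \sum_(i <- s) F i p.
Proof. by elim/big_rec2: _ => // i x y _ <-. Qed.

Lemma dirac_chainP A B : (forall p, A p = B p) <-> A = B.
Proof. by split=> [AB|->//]; apply/val_inj/funext. Qed.

Lemma diracE p a q : dirac p a q = (if q == p then a else 0) :> kvector R n k.
Proof. by []. Qed.

Lemma dirac_funZ c A p : (c *: A) p = c *: A p. Proof. by []. Qed.

Lemma diracZ c p a : dirac p (c *: a) = c *: dirac p a :> chain.
Proof.
apply/dirac_chainP => q; rewrite dirac_funZ !diracE.
by case: ifP => // _; rewrite scaler0.
Qed.

Lemma dirac0 p : dirac p 0 = 0 :> chain.
Proof. by rewrite -(scale0r 0) diracZ scale0r. Qed.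

Lemma translate_diffZ c u p a :
  translate_diff u p (c *: a) = c *: translate_diff u p a :> chain.
Proof. by rewrite /translate_diff !diracZ scalerBr. Qed.

Lemma translate_diff0 p a : translate_diff 0 p a = 0 :> chain.
Proof. by rewrite /translate_diff addr0 subrr. Qed.

Lemma B1_decomp_neq0 A : B1_decomp A !=set0.
Proof.
have /finite_seqP[s0 sE] := elimT (finsuppP A) (dirac_funP A).
exists ([seq (p, A p) | p <- undup s0], [::]).
rewrite /B1_decomp/= big_nil addr0 big_map/=.
apply/dirac_chainP => q; rewrite dirac_fun_sum /=.
have [qs|qs] := boolP (q \in undup s0).
  rewrite (bigD1_seq q)//= ?undup_uniq// eqxx big1 ?addr0// => p /negPf.
  by rewrite eq_sym => ->.
rewrite big_seq big1 => [|p ps].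
  apply/eqP/negPn; apply: contra qs => qA.
  by rewrite mem_undup; have : [set` s0] q by rewrite -sE.
by case: eqP => // qp; rewrite qp ps in qs.
Qed.

Lemma B1_cost_ge0 (d : seq ('rV[R]_n * kvector R n k) *
    seq ('rV[R]_n * 'rV[R]_n * kvector R n k)) : 0 <= B1_cost d.
Proof.
by rewrite addr_ge0// sumr_ge0// => y _; rewrite ?mulr_ge0 ?enorm_ge0 ?mass_ge0.
Qed.

Lemma B1_has_inf A : has_inf [set B1_cost d | d in B1_decomp A].
Proof.
split; last by exists 0 => _ [d _ <-]; exact: B1_cost_ge0.
by have [d hd] := B1_decomp_neq0 A; exists (B1_cost d), d.
Qed.

Lemma B1norm_le A d : B1_decomp A d -> B1norm A <= B1_cost d.
Proof. by move=> h; apply: ge_inf; [case: (B1_has_inf A)|exists d]. Qed.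

Lemma le_B1norm A r : (forall d, B1_decomp A d -> r <= B1_cost d) -> r <= B1norm A.
Proof.
move=> h; apply: lb_le_inf; first by case: (B1_has_inf A).
by move=> _ [d hd <-]; exact: h.
Qed.

Lemma B1norm_ge0 A : 0 <= B1norm A.
Proof. by apply: le_B1norm => d _; exact: B1_cost_ge0. Qed.

Lemma B1norm0 : B1norm (0 : chain) = 0.
Proof.
apply/le_anti; rewrite B1norm_ge0 andbT.
have /B1norm_le : B1_decomp (0 : chain) ([::], [::]).
  by rewrite /B1_decomp/= !big_nil addr0.
by rewrite /B1_cost/= !big_nil addr0.
Qed.

Lemma B1normD A B : B1norm (A + B) <= B1norm A + B1norm B.
Proof.
rewrite -lerBlDr; apply: le_B1norm => d dA; rewrite lerBlDr [leRHS]addrC -lerBlDr.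
apply: le_B1norm => e eB; rewrite lerBlDr.
have /B1norm_le : B1_decomp (A + B) (d.1 ++ e.1, d.2 ++ e.2).
  by rewrite /B1_decomp/= !big_cat/= addrACA {1}dA {1}eB.
by move=> /le_trans; apply; rewrite /B1_cost/= !big_cat/= addrACA addrC.
Qed.

Lemma B1normZ c A : B1norm (c *: A) = `|c| * B1norm A.
Proof.
have le d B : B1norm (d *: B) <= `|d| * B1norm B.
  have [->|d0] := eqVneq d 0; first by rewrite scale0r normr0 mul0r B1norm0.
  rewrite mulrC -ler_pdivrMr ?normr_gt0//; apply: le_B1norm => e eB.
  rewrite ler_pdivrMr ?normr_gt0//.
  have /B1norm_le : B1_decomp (d *: B)
      ([seq (x.1, d *: x.2) | x <- e.1], [seq (x.1, d *: x.2) | x <- e.2]).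
    rewrite /B1_decomp/= !big_map/= {1}eB scalerDr !scaler_sumr.
    congr (_ + _); apply: eq_bigr => x _; first by rewrite diracZ.
    by rewrite translate_diffZ.
  move=> /le_trans; apply; rewrite /B1_cost/= !big_map/= mulrDl !mulr_suml.
  rewrite le_eqVlt; apply/orP; left; apply/eqP.
  congr (_ + _); apply: eq_bigr => x _; rewrite massZ; first by rewrite mulrC.
  by rewrite mulrCA mulrC.
apply/le_anti; rewrite le/=; have [->|c0] := eqVneq c 0.
  by rewrite normr0 mul0r B1norm_ge0.
rewrite -ler_pdivlMl ?normr_gt0// -normfV -[A in B1norm A <= _]scale1r.
by rewrite -(mulVf c0) -scalerA le.
Qed.

Lemma B1normN A : B1norm (- A) = B1norm A.
Proof. by rewrite -scaleN1r B1normZ normrN1 mul1r. Qed.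

Lemma B1normB A B C : B1norm (A - C) <= B1norm (A - B) + B1norm (B - C).
Proof. by rewrite -[A - C](subrKA B) B1normD. Qed.

Lemma bounded_lipschitz_le (w : {scalar chain}) : bounded_lipschitz w ->
  exists2 M, 0 <= M & forall A, `|w A| <= M * B1norm A.
Proof.
move=> [[M1 h1] [M2 h2]]; pose M := `|M1| + `|M2|.
have M0 : 0 <= M by rewrite addr_ge0.
have le1 p a : `|w (dirac p a)| <= M * mass a.
  have [a0|a0] := eqVneq (mass a) 0.
    by rewrite a0 (mass_eq0 a0) dirac0 linear0 normr0 mulr0.
  have am : 0 < mass a by rewrite lt_neqAle eq_sym a0 mass_ge0.
  rewrite -ler_pdivrMr//.
  have : `|w (dirac p ((mass a)^-1 *: a))| <= M1.
    apply: h1; exists p, ((mass a)^-1 *: a); split=> //.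
    by rewrite massZ gtr0_norm ?invr_gt0// mulVf.
  rewrite diracZ linearZ/= normrM gtr0_norm ?invr_gt0// mulrC => /le_trans; apply.
  by rewrite (le_trans (ler_norm _))// lerDl.
have le2 u p a : `|w (translate_diff u p a)| <= M * (enorm u * mass a).
  have [a0|a0] := eqVneq (enorm u * mass a) 0.
    move/eqP: (a0); rewrite mulf_eq0 => /orP[/eqP/enorm_eq0 ->|/eqP/mass_eq0 ->].
      by rewrite translate_diff0 linear0 normr0 mulr_ge0// mulr_ge0 ?enorm_ge0 ?mass_ge0.
    rewrite /translate_diff !dirac0 subr0 linear0 normr0.
    by rewrite mulr_ge0// mulr_ge0 ?enorm_ge0 ?mass_ge0.
  set m := enorm u * mass a in a0 *.
  have am : 0 < m by rewrite lt_neqAle eq_sym a0 mulr_ge0 ?enorm_ge0 ?mass_ge0.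
  rewrite -ler_pdivrMr//.
  have : `|w (translate_diff u p (m^-1 *: a))| <= M2.
    apply: h2; exists u, p, (m^-1 *: a); split=> //.
    by rewrite massZ mulrCA gtr0_norm ?invr_gt0// mulVf.
  rewrite translate_diffZ linearZ/= normrM gtr0_norm ?invr_gt0// mulrC.
  by move=> /le_trans; apply; rewrite (le_trans (ler_norm _))// lerDr.
exists M => // A; have [M00|M00] := eqVneq M 0.
  have [d ->] := B1_decomp_neq0 A; rewrite M00 mul0r linearD !linear_sum/=.
  rewrite (le_trans (ler_normD _ _))// -[leRHS]addr0 lerD//.
    rewrite (le_trans (ler_norm_sum _ _ _))// sumr_le0// => x _.
    by rewrite (le_trans (le1 _ _))// M00 mul0r.
  rewrite (le_trans (ler_norm_sum _ _ _))// sumr_le0// => x _.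
  by rewrite (le_trans (le2 _ _ _))// M00 mul0r.
rewrite -ler_pdivrMl ?lt_neqAle 1?eq_sym ?M00//; apply: le_B1norm => d dA.
rewrite ler_pdivrMl ?lt_neqAle 1?eq_sym ?M00// dA linearD !linear_sum/=.
rewrite (le_trans (ler_normD _ _))// mulrDr !mulr_sumr lerD//.
  by rewrite (le_trans (ler_norm_sum _ _ _))// ler_sum.
by rewrite (le_trans (ler_norm_sum _ _ _))// ler_sum.
Qed.

End B1Theory.

Section Completion.
Variables (R : realType) (n k : nat).
Local Notation chain := (dirac_chain R n k).

Definition B1_cauchy (A : nat -> chain) : Prop :=
  forall e : R, 0 < e -> exists N : nat, forall i j : nat,
    (N <= i)%N -> (N <= j)%N -> B1norm (A i - A j) < e.

Definition cauchy_chain := {A : nat -> chain | `[< B1_cauchy A >]}.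

Definition cauchy_equiv (A B : cauchy_chain) : bool :=
  `[< B1norm (val A i - val B i) @[i --> \oo] --> (0 : R) >].

Lemma cauchy_equiv_refl : reflexive cauchy_equiv.
Proof.
move=> A; apply/asboolP; under eq_fun do rewrite subrr B1norm0.
exact: cvg_cst.
Qed.

Lemma cauchy_equiv_sym : symmetric cauchy_equiv.
Proof.
move=> A B; apply: asbool_equiv_eq.
by split; under eq_fun do rewrite -B1normN opprB.
Qed.

Lemma cauchy_equiv_trans : transitive cauchy_equiv.
Proof.
move=> B A C /asboolP AB /asboolP BC; apply/asboolP.
apply: (@squeeze_cvgr nat \oo _ R (fun=> 0) (fun i =>
  B1norm (val A i - val B i) + B1norm (val B i - val C i))).
- by apply: nearW => i; rewrite B1norm_ge0; exact: B1normB.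
- exact: cvg_cst.
- by rewrite -[X in _ --> X]addr0; exact: cvgD AB BC.
Qed.

Canonical cauchy_equiv_rel :=
  EquivRel cauchy_equiv cauchy_equiv_refl cauchy_equiv_sym cauchy_equiv_trans.

(* Differential k-chains: the completion of the Dirac k-chains in the B^1 norm,
   as classes of Cauchy sequences. *)
Definition diff_chain := {eq_quot cauchy_equiv_rel}.

Definition B1_cvg (A : nat -> chain) (J : diff_chain) : Prop :=
  exists2 C : cauchy_chain, val C = A & \pi_diff_chain C = J.

(* The limit does not depend on the approximating sequence, see
   [chain_int_cvg]. *)
Definition chain_int (J : diff_chain) (w : {scalar chain}) : R :=
  lim (w (val (repr J) i) @[i --> \oo]).

Lemma chain_int_cvg (w : {scalar chain}) (A : nat -> chain) (J : diff_chain) :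
  bounded_lipschitz w -> B1_cvg A J -> w (A i) @[i --> \oo] --> chain_int J w.
Proof.
move=> /bounded_lipschitz_le[M M0 wM] [C <- CJ].
have wC (D : cauchy_chain) : cvgn (fun i => w (val D i)).
  apply/cauchy_cvgP/cauchy_exP => e e0.
  have M1 : 0 < M + 1 by rewrite ltr_wpDl.
  have [N DN] := elimT (asboolP _) (valP D) (e / (M + 1)) (divr_gt0 e0 M1).
  exists (w (val D N)); exists N => // i /= Ni; rewrite -ball_normE /ball_/=.
  rewrite -linearB (le_lt_trans (wM _))//.
  rewrite (@le_lt_trans _ _ ((M + 1) * B1norm (val D N - val D i)))//.
    by rewrite ler_wpM2r ?B1norm_ge0// lerDl.
  by rewrite mulrC -ltr_pdivlMr// DN.
have /eqmodP/asboolP rC : repr J = C %[mod diff_chain] by rewrite reprK CJ.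
have d0 : w (val (repr J) i - val C i) @[i --> \oo] --> (0 : R).
  apply/norm_cvg0P; apply: (@squeeze_cvgr _ _ _ _ (cst 0)
      (fun i => M * B1norm (val (repr J) i - val C i))).
  - by apply: nearW => i; rewrite normr_ge0 wM.
  - exact: cvg_cst.
  - by rewrite -(mulr0 M); exact: cvgM (cvg_cst M) rC.
have -> : (fun i => w (val C i)) =
    (fun i => w (val (repr J) i) - w (val (repr J) i - val C i)).
  by apply/funext => i; rewrite linearB/= subKr.
by rewrite -[chain_int J w]subr0; exact: cvgB (wC (repr J)) d0.
Qed.

End Completion.

Section Riemann.
Variables (R : realType) (k : nat).
Local Notation V := 'rV[R]_k.

Definition closed_box (a b : V) : set V := [set x | forall i, a 0 i <= x 0 i <= b 0 i].
Definition open_box (a b : V) : set V := [set x | forall i, a 0 i < x 0 i < b 0 i].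

Definition box_volume (a b : V) : R := \prod_i (b 0 i - a 0 i).

(* The boxes [l j, u j] are non-overlapping, tile the box [a, b], have sides
   shorter than d, and are tagged by the points t j. *)
Definition tagged_partition (a b : V) (d : R) (m : nat) (l u t : 'I_m -> V) : Prop :=
  [/\ \bigcup_j closed_box (l j) (u j) = closed_box a b,
      trivIset setT (fun j => open_box (l j) (u j)),
      forall j, closed_box (l j) (u j) (t j) &
      forall j i, u j 0 i - l j 0 i < d].

(* The Riemann integral of f over P exists and equals I. *)
Definition is_riemann_int (P : set V) (f : V -> R) (I : R) : Prop :=
  exists a b : V, P `<=` closed_box a b /\
    forall e : R, 0 < e -> exists2 d : R, 0 < d &
      forall (m : nat) (l u t : 'I_m -> V), tagged_partition a b d l u t ->
        `|\sum_j (f \_ P) (t j) * box_volume (l j) (u j) - I| < e.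

Definition open_half_space (v : V) (c : R) : set V := [set x | dot v x < c].
Definition closed_half_space (v : V) (c : R) : set V := [set x | dot v x <= c].

(* A cell of full dimension k in R^k. *)
Definition affine_cell (P : set V) : Prop :=
  compact (closure P) /\
  exists m (v : 'I_m -> V) (c : 'I_m -> R), (forall j, v j != 0) /\
    (P = \bigcap_j open_half_space (v j) (c j) \/
     P = \bigcap_j closed_half_space (v j) (c j)).

End Riemann.

Section OrientedCells.
Variables (R : realType) (n k : nat).

(* A k-cell in the affine subspace through [cell_pt] spanned by the rows of
   [cell_frame], read in the affine coordinates given by that frame.  The frame
   orients the subspace; [cell_neg] reverses the orientation, which is needed
   when k = 0. *)
Record oriented_cell := OrientedCell {
  cell_set :> set 'rV[R]_n;
  cell_pt : 'rV[R]_n;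
  cell_frame : 'M[R]_(k, n);
  cell_neg : bool;
  cell_frame_free : row_free cell_frame;
  cell_setP : exists2 P : set 'rV[R]_k, affine_cell P &
    cell_set = [set cell_pt + x *m cell_frame | x in P] }.

Definition cell_map (s : oriented_cell) (x : 'rV[R]_k) : 'rV[R]_n :=
  cell_pt s + x *m cell_frame s.

Definition cell_kvector (s : oriented_cell) : kvector R n k :=
  (-1) ^+ cell_neg s *: wedge (cell_frame s).

(* The Riemann integral of the form w over s is that of its pullback by the
   affine parametrization; for an orthonormal frame the pullback is w evaluated
   on the unit k-vector orienting s. *)
Definition is_cell_int (s : oriented_cell) (w : {scalar dirac_chain R n k}) (I : R)
    : Prop :=
  is_riemann_int (cell_map s @^-1` s)
    (fun x => w (dirac (cell_map s x) (cell_kvector s))) I.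

End OrientedCells.

(* Main.v *)
Require Import Defs.
From HB Require Import structures.
From mathcomp Require Import all_boot all_order all_algebra.
From mathcomp Require Import all_classical all_reals.
From mathcomp Require Import topology normedtype sequences.
From mathcomp Require Import lra.

(** Existence.  Integrate not one form but all of them at once: the map sending
    [x] in the cell to the Dirac chain [(cell_map s x; alpha)], where [alpha] is
    the orienting k-vector, has Riemann sums that are Dirac chains, and applying a
    form to such a sum gives the Riemann sum of the pulled back form.  So it is
    enough to show that these chains form a Cauchy net in the [B1norm]
    ([riemann_chain_close]): the limit is the required differential chain, and
    every bounded Lipschitz form, being continuous for the norm, is
    Riemann integrable with the value of the limit as its integral
    ([riemann_chain_limit]).

    For the Cauchy estimate, two Riemann sums of mesh [d] are compared with the
    sum over a fine regular grid ([riemann_chain_grid]).  Within the cell, moving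
    a point by [d] costs [O(d)] per unit volume, by the translation terms of the
    norm.  A Dirac term cannot be cancelled where the tag and the grid
    point lie on different sides of the boundary; there one of the
    finitely many bounding hyperplanes is at distance at most [d], and
    the slab around it has volume [O(d)] ([B1norm_pulled_diracB],
    [grid_content_slab_uniform]).  All volumes are measured by counting grid
    points and letting the step tend to 0 ([cvg_grid_content]), which
    avoids any common refinement of the two partitions.

    Uniqueness.  The Riemann integral has at most one value, whatever the
    enclosing boxes ([riemann_int_unique]), so two solutions give the
    same integral to all bounded Lipschitz forms.  Linear forms dominated by
    the [B1norm] are bounded Lipschitz, and by the Hahn-Banach theorem
    ([hahn_banach]) they separate the points of the completion
    ([diff_chain_separated]).  Hahn-Banach is obtained by showing that minimal
    sublinear functions are linear. *)

Set Implicit Arguments.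
Unset Strict Implicit.
Unset Printing Implicit Defensive.

Import Order.TTheory GRing.Theory Num.Theory.
Import numFieldNormedType.Exports.

Local Open Scope classical_set_scope.
Local Open Scope ring_scope.

(** * The Hahn-Banach theorem for sublinear functions *)

Section HahnBanach.
Variables (R : realType) (V : lmodType R).

Definition sublinear (q : V -> R) : Prop :=
  (forall x y, q (x + y) <= q x + q y) /\
  (forall c x, 0 <= c -> q (c *: x) = c * q x).

Lemma sublinear0 q : sublinear q -> q 0 = 0.
Proof. by move=> [_ qZ]; rewrite -(scale0r 0) qZ// mul0r. Qed.

Lemma sublinear_geN q x : sublinear q -> - q (- x) <= q x.
Proof.
move=> qS; rewrite lerNl -subr_ge0 opprK -(sublinear0 qS) -(addNr x).
by case: qS => qD _; apply: qD.
Qed.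

(** The members of the family need not be sublinear: it is enough that rescaling
    or adding the arguments can be compensated by passing to another member.  So
    this one criterion covers both the infimum of a chain of sublinear functions
    and the infimum that defines [tilt]. *)
Lemma sublinear_inf (I : Type) (D : set I) (q : I -> V -> R) (b : V -> R) :
  (forall i x, D i -> b x <= q i x) ->
  (forall i c x, D i -> 0 < c -> exists2 j, D j & q j (c *: x) <= c * q i x) ->
  (forall i j x y, D i -> D j -> exists2 l, D l & q l (x + y) <= q i x + q j y) ->
  (forall i, D i -> 0 <= q i 0) ->
  (exists2 i, D i & q i 0 <= 0) ->
  sublinear (fun x => inf [set q i x | i in D]).
Proof.
move=> qb qZ qD q0 [i1 Di1 q10].
have infE x i : D i -> inf [set q i x | i in D] <= q i x.
  by move=> Di; apply: ge_inf; [exists (b x) => _ [j Dj <-]; exact: qb|exists i].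
have infG x r : (forall i, D i -> r <= q i x) -> r <= inf [set q i x | i in D].
  move=> h; apply: lb_le_inf; first by exists (q i1 x), i1.
  by move=> _ [i Di <-]; exact: h.
have leZ c x : 0 < c ->
    inf [set q i (c *: x) | i in D] <= c * inf [set q i x | i in D].
  move=> c0; rewrite -ler_pdivrMl//; apply: (infG) => i Di.
  rewrite ler_pdivrMl//; have [j Dj] := qZ i c x Di c0.
  by apply: le_trans; exact: infE.
split=> [x y|c x] /=.
  rewrite -lerBlDr; apply: (infG) => i Di; rewrite lerBlDr [leRHS]addrC -lerBlDr.
  apply: (infG) => j Dj; rewrite lerBlDr [leRHS]addrC.
  by have [l Dl] := qD i j x y Di Dj; apply: le_trans; exact: infE.
rewrite le_eqVlt => /predU1P[<-|c0].
  rewrite scale0r mul0r; apply/le_anti; rewrite infG// andbT.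
  exact: le_trans (infE _ _ Di1) q10.
apply/le_anti; rewrite leZ//= -ler_pdivlMl//.
have := leZ c^-1 (c *: x); rewrite scalerA mulVf ?gt_eqF// scale1r.
by apply; rewrite invr_gt0.
Qed.

(** The largest sublinear function below [q] whose value at [- y] is at most
    [- q y]: it flattens [q] along the line through [y]. *)
Definition tilt (q : V -> R) (y x : V) : R :=
  inf [set q (x + t *: y) - t * q y | t in [set t : R | 0 <= t]].

Lemma tilt_bound q y x t : sublinear q -> 0 <= t ->
  - q (- x) <= q (x + t *: y) - t * q y.
Proof.
move=> qS t0; have := qS.1 (x + t *: y) (- x).
by rewrite addrAC subrr add0r (qS.2 _ _ t0); lra.
Qed.

Lemma tilt_le_point q y x t : sublinear q -> 0 <= t ->
  tilt q y x <= q (x + t *: y) - t * q y.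
Proof.
move=> qS t0; apply: ge_inf; last by exists t.
by exists (- q (- x)) => _ [c c0 <-]; exact: tilt_bound.
Qed.

Lemma tilt_le q y x : sublinear q -> tilt q y x <= q x.
Proof.
move=> qS; have := tilt_le_point y x qS (lexx 0).
by rewrite scale0r addr0 mul0r subr0.
Qed.

Lemma tilt_sublinear q y : sublinear q -> sublinear (tilt q y).
Proof.
move=> qS; apply: (@sublinear_inf _ _ _ (fun x => - q (- x))).
- by move=> c x c0; exact: tilt_bound.
- move=> t c x /= t0 c0; exists (c * t); first by rewrite /= mulr_ge0// ltW.
  by rewrite -scalerA -scalerDr qS.2 ?(ltW c0)// -mulrA mulrBr.
- move=> s t x z /= s0 t0; exists (s + t); first by rewrite /= addr_ge0.
  rewrite mulrDl opprD addrACA lerD2r scalerDl addrACA.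
  exact: qS.1.
- by move=> t /= t0; rewrite add0r qS.2// subrr.
- by exists 0 => //=; rewrite scale0r addr0 mul0r subr0 (sublinear0 qS).
Qed.

Lemma tilt_opp q y : sublinear q -> tilt q y (- y) <= - q y.
Proof.
move=> qS; apply: le_trans (tilt_le_point _ _ qS ler01) _.
by rewrite scale1r addNr (sublinear0 qS) mul1r sub0r.
Qed.

(** By Zorn's lemma: a chain of sublinear functions below [p] has a sublinear
    infimum, since each of them is bounded below by [- p (- x)]. *)
Lemma minimal_sublinear p : sublinear p ->
  exists q, [/\ sublinear q, forall x, q x <= p x &
    forall r, sublinear r -> (forall x, r x <= q x) -> r = q].
Proof.
move=> pS; pose T := {q : V -> R | sublinear q /\ forall x, q x <= p x}.
pose rel (q r : T) := `[< forall x, sval r x <= sval q x >].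
have [| | | |[q [qS qp]] qmin] := @Zorn T rel.
- by move=> q; apply/asboolP => x.
- move=> q r s /asboolP qr /asboolP rs; apply/asboolP => x.
  exact: le_trans (rs x) (qr x).
- move=> [q hq] [r hr] /asboolP qr /asboolP rq; apply: eq_exist; apply/funext => x.
  by apply/le_anti; rewrite (qr x) (rq x).
- move=> A Atot; have [[t0 At0]|A0] := pselect (A !=set0); last first.
    exists (exist _ p (conj pS (fun x => lexx _))) => s As.
    by exfalso; apply: A0; exists s.
  have qb (i : T) x : A i -> - p (- x) <= sval i x.
    move=> _; case: i => q [qS qp]/=; apply: le_trans (sublinear_geN x qS).
    by rewrite lerN2.
  have iS : sublinear (fun x => inf [set sval i x | i in A]).
    apply: (@sublinear_inf _ _ (fun i => sval i) (fun x => - p (- x))) => //.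
    + move=> i c x Ai c0; exists i => //; case: i {Ai} => q [qS qp]/=.
      by rewrite qS.2// ltW.
    + move=> i j x y Ai Aj.
      have [/asboolP ij|/asboolP ji] := Atot _ _ Ai Aj.
      * exists j => //; rewrite (le_trans ((svalP j).1.1 _ _))//.
        by rewrite lerD2r.
      * exists i => //; rewrite (le_trans ((svalP i).1.1 _ _))//.
        by rewrite lerD2l.
    + by move=> [q [qS qp]] _ /=; rewrite (sublinear0 qS).
    + by exists t0 => //; rewrite (sublinear0 (svalP t0).1).
  have ile i x : A i -> inf [set sval i x | i in A] <= sval i x.
    by move=> Ai; apply: ge_inf; [exists (- p (- x)) => _ [j Aj <-]; exact: qb|exists i].
  have ip x : inf [set sval i x | i in A] <= p x.
    by rewrite (le_trans (ile _ _ At0))//; exact: (svalP t0).2.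
  pose infT : T := exist _ (fun x => inf [set sval i x | i in A]) (conj iS ip).
  by exists infT => s As; apply/asboolP => x; exact: ile.
exists q; split=> // r rS rq.
have rp x : r x <= p x by apply: le_trans (rq x) (qp x).
pose rT : T := exist _ r (conj rS rp).
by have /(congr1 sval) := qmin rT (introT (asboolP _) rq).
Qed.

(** A minimal [q] equals its own tilt along [y], and evaluating the tilt at
    parameter 1 gives [q x <= q (x + y) - q y]. *)
Lemma minimal_sublinear_additive q : sublinear q ->
  (forall r, sublinear r -> (forall x, r x <= q x) -> r = q) ->
  forall x y, q (x + y) = q x + q y.
Proof.
move=> qS qmin x y; apply/le_anti; rewrite qS.1/= -lerBrDr.
rewrite -{1}(qmin _ (tilt_sublinear y qS) (fun z => tilt_le y z qS)).
by rewrite (le_trans (tilt_le_point _ _ qS ler01))// scale1r mul1r.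
Qed.

(** A minimal sublinear function below [p] is linear, but need not touch [p] at
    [x0].  Starting from the tilt of [p] along [x0] instead forces the value at
    [- x0] down to [- p x0], and linearity turns this into equality at [x0]. *)
Lemma hahn_banach (p : V -> R) (x0 : V) : sublinear p ->
  exists w : {scalar V}, (forall x, w x <= p x) /\ w x0 = p x0.
Proof.
move=> pS; have [q [qS qp qmin]] := minimal_sublinear (tilt_sublinear x0 pS).
have qD := minimal_sublinear_additive qS qmin.
have qN x : q (- x) = - q x.
  by apply/eqP; rewrite -addr_eq0 -qD addNr (sublinear0 qS).
have qlin : linear_for *%R q.
  move=> c x y; rewrite qD; congr (_ + _).
  have [c0|c0] := leP 0 c; first exact: qS.2.
  by rewrite -[c]opprK scaleNr qN qS.2 ?mulNr// oppr_ge0 ltW.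
pose w : {scalar V} := HB.pack q (GRing.isLinear.Build _ _ _ _ q qlin).
exists w; split=> [x|]; first exact: le_trans (qp x) (tilt_le _ _ pS).
apply/le_anti; rewrite (le_trans (qp x0) (tilt_le _ _ pS))/=.
rewrite -lerN2 -qN; exact: le_trans (qp _) (tilt_opp _ pS).
Qed.

End HahnBanach.

(** * Bounded Lipschitz forms separate differential chains *)

Section Duality.
Variables (R : realType) (n k : nat).
Local Notation chain := (dirac_chain R n k).

Lemma B1norm_dirac p a : B1norm (dirac p a : chain) <= mass a.
Proof.
have /B1norm_le : B1_decomp (dirac p a : chain) ([:: (p, a)], [::]).
  by rewrite /B1_decomp/= big_seq1 big_nil addr0.
by rewrite /B1_cost/= big_seq1 big_nil addr0.
Qed.

Lemma B1norm_translate_diff u p a :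
  B1norm (translate_diff u p a : chain) <= enorm u * mass a.
Proof.
have /B1norm_le : B1_decomp (translate_diff u p a : chain) ([::], [:: (u, p, a)]).
  by rewrite /B1_decomp/= big_seq1 big_nil add0r.
by rewrite /B1_cost/= big_seq1 big_nil add0r.
Qed.

Lemma B1norm_sum (I : Type) (r : seq I) (P : pred I) (F : I -> chain) :
  B1norm (\sum_(i <- r | P i) F i) <= \sum_(i <- r | P i) B1norm (F i).
Proof.
elim/big_rec2: _ => [|i x y _ xy]; first by rewrite B1norm0.
by rewrite (le_trans (B1normD _ _))// lerD2l.
Qed.

Lemma B1norm_sublinear : sublinear (@B1norm R n k).
Proof.
split=> [A B|c A c0]; first exact: B1normD.
by rewrite B1normZ ger0_norm.
Qed.

Lemma le_B1norm_bounded_lipschitz (w : {scalar chain}) :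
  (forall A, w A <= B1norm A) -> bounded_lipschitz w.
Proof.
move=> wB; have wN A : `|w A| <= B1norm A.
  by rewrite ler_norml wB andbT lerNl -linearN -[B1norm A]B1normN wB.
split.
  exists 1 => _ [p [a [a1 ->]]]; rewrite (le_trans (wN _))// -a1.
  exact: B1norm_dirac.
exists 1 => _ [u [p [a [a1 ->]]]]; rewrite (le_trans (wN _))// -a1.
exact: B1norm_translate_diff.
Qed.

(** Suppose the difference [D] of the representing Cauchy sequences varies by less
    than [e / 2] from some index on.  For a late term [D i], Hahn-Banach gives a
    form of norm at most 1 whose value on [D i] is the norm of [D i].  Its values
    along [D] tend to 0 by assumption, so the norm of [D i] is at most [e / 2]. *)
Lemma diff_chain_separated (J J' : diff_chain R n k) :
  (forall w : {scalar chain}, bounded_lipschitz w ->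
    chain_int J w = chain_int J' w) -> J = J'.
Proof.
move=> JJ'; rewrite -[J]reprK -[J']reprK; apply/eqmodP/asboolP.
pose D i := val (repr J) i - val (repr J') i.
have cvgJ (K : diff_chain R n k) : B1_cvg (val (repr K)) K.
  by exists (repr K) => //; exact: reprK.
have Dcauchy e : 0 < e -> exists N : nat, forall i j : nat,
    (N <= i)%N -> (N <= j)%N -> B1norm (D i - D j) < e.
  move=> e0; have e2 : 0 < e / 2 by rewrite divr_gt0.
  have [N1 h1] := elimT (asboolP _) (valP (repr J)) _ e2.
  have [N2 h2] := elimT (asboolP _) (valP (repr J')) _ e2.
  exists (maxn N1 N2) => i j; rewrite !geq_max => /andP[i1 i2] /andP[j1 j2].
  have -> : D i - D j = (val (repr J) i - val (repr J) j)
                      - (val (repr J') i - val (repr J') j).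
    by rewrite /D !opprB addrACA [RHS]addrACA; congr (_ + _); rewrite addrC.
  rewrite [e]splitr (le_lt_trans (B1normD _ _))// B1normN.
  by rewrite ltrD// ?h1// h2.
apply/cvgrPdist_lt => e e0; have [N DN] := Dcauchy _ (divr_gt0 e0 (ltr0n R 2)).
exists N => // i /= Ni; rewrite sub0r normrN ger0_norm ?B1norm_ge0//.
have [w [wB wDi]] := hahn_banach (D i) B1norm_sublinear.
have wBL := le_B1norm_bounded_lipschitz wB.
have wD0 : w (D j) @[j --> \oo] --> (0 : R).
  rewrite -(subrr (chain_int J w)) {2}JJ'//.
  have -> : (fun j => w (D j)) = (fun j => w (val (repr J) j) - w (val (repr J') j)).
    by apply/funext => j; rewrite /D linearB.
  by apply: cvgB; exact: chain_int_cvg.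
rewrite -/(D i) -wDi [e]splitr.
apply: (@le_lt_trans _ _ (e / 2)); last by rewrite ltrDl divr_gt0.
rewrite -subr_le0; apply: (cvgr_to_ge wD0); exists N => // j /= Nj.
rewrite lerBlDr -lerBlDl -linearB (le_trans (wB _))// ltW//.
exact: DN.
Qed.

End Duality.

(** * Counting the points of an arithmetic progression in an interval *)

Section GridCount.
Variable R : realType.

Definition clamp (a b c : R) : R := if c <= a then a else if c <= b then c else b.

Lemma clamp_bounds a b c : a <= b -> a <= clamp a b c <= b.
Proof. by move=> ab; rewrite /clamp; case: (leP c a) => ?; case: (leP c b) => ?; lra. Qed.

Lemma clamp_mono a b c d : a <= b -> c <= d -> clamp a b c <= clamp a b d.
Proof.
move=> ab cd; have := clamp_bounds c ab; have := clamp_bounds d ab; rewrite /clamp.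
by case: (leP c a) => ?; case: (leP d a) => ?; case: (leP c b) => ?; case: (leP d b) => ?; lra.
Qed.

Lemma clamp_id a b c : a <= c <= b -> clamp a b c = c.
Proof.
move=> ?; rewrite /clamp; case: (leP c a) => ?; first by lra.
by case: (leP c b) => ?; lra.
Qed.

Lemma clamp_le a b c : c <= a -> clamp a b c = a.
Proof. by move=> ca; rewrite /clamp ca. Qed.

Lemma clamp_ge a b c : a <= b -> b <= c -> clamp a b c = b.
Proof.
move=> ab bc; rewrite /clamp; case: (leP c a) => ?; first by lra.
by case: (leP c b) => ?; lra.
Qed.

(** The number of grid points in an interval is compared with its length through
    this telescoping sum.  The [F] to be used are clamping functions, whose
    increments over one step vanish away from the interval and equal the step
    inside it. *)
Lemma telescope_grid (F : R -> R) (x0 h : R) N :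
  \sum_(m < N) (F (x0 + m%:R * h + h) - F (x0 + m%:R * h)) =
  F (x0 + N%:R * h) - F x0.
Proof.
have -> : F x0 = F (x0 + 0%:R * h) by rewrite mul0r addr0.
rewrite -(telescope_sumr (fun m => F (x0 + m%:R * h)))// big_mkord.
by apply: eq_bigr => m _; rewrite -[m.+1]addn1 natrD mulrDl mul1r addrA.
Qed.

Lemma grid_count_le (x0 h l u : R) N : 0 < h -> l <= u ->
  \sum_(m < N | l <= x0 + m%:R * h <= u) h <= u - l + h.
Proof.
move=> h0 lu; have lh : l <= u + h by lra.
(* Each counted point x contributes the whole increment over [x, x + h], so the
   upper end is moved by h to leave room for the last of them. *)
pose F := clamp l (u + h).
apply: (@le_trans _ _ (F (x0 + N%:R * h) - F x0)); last first.
  by have := clamp_bounds (x0 + N%:R * h) lh; have := clamp_bounds x0 lh; rewrite /F; lra.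
rewrite -telescope_grid big_mkcond/=; apply: ler_sum => m _; rewrite /F.
set x := x0 + _; case: ifP => [/andP[lx xu]|_].
  by rewrite !clamp_id; lra.
by rewrite subr_ge0 clamp_mono//; lra.
Qed.

Lemma grid_count_ge (x0 h l u : R) N : 0 < h -> x0 <= l -> u <= x0 + N%:R * h ->
  u - l - h <= \sum_(m < N | l < x0 + m%:R * h < u) h.
Proof.
move=> h0 x0l uN; have [lu|lu] := leP (l + h) u; last first.
  by rewrite (@le_trans _ _ 0)// ?sumr_ge0// => [|*]; [lra|exact: ltW].
(* The step that enters the interval starts at a point that is not counted, so
   the lower end is moved by h to cancel its contribution. *)
pose F := clamp (l + h) u.
apply: (@le_trans _ _ (F (x0 + N%:R * h) - F x0)).
  by rewrite /F [X in _ <= X - _]clamp_ge// clamp_le//; lra.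
rewrite -telescope_grid [leRHS]big_mkcond/=; apply: ler_sum => m _; rewrite /F.
set x := x0 + _; case: ifP => [/andP[lx xu]|/negbT].
  have xh : l + h <= x + h by lra.
  rewrite /clamp; case: (leP x (l + h)) => ?; case: (leP x u) => ?;
    by case: (leP (x + h) (l + h)) => ?; case: (leP (x + h) u) => ?; lra.
rewrite negb_and -!leNgt => /orP[xl|ux]; last by rewrite !clamp_ge//; lra.
by rewrite !clamp_le//; lra.
Qed.

End GridCount.

(** * Volumes of boxes and slabs by counting grid points *)

Section Grid.
Variables (R : realType) (k : nat) (K : R).
Hypothesis K0 : 0 < K.

Definition grid_step (N : nat) : R := (K + K) / N.+1%:R.

Definition grid_coord (N m : nat) : R := - K + m%:R * grid_step N.

Definition grid_pt (N : nat) (g : {ffun 'I_k -> 'I_N.+1}) : 'rV[R]_k :=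
  \row_i grid_coord N (g i).

(** Total volume of the grid cells whose corner is selected by [B]: a discrete
    substitute for the Lebesgue measure. *)
Definition grid_content (N : nat) (B : pred {ffun 'I_k -> 'I_N.+1}) : R :=
  \sum_(g | B g) grid_step N ^+ k.

Lemma grid_step_gt0 N : 0 < grid_step N.
Proof. by rewrite divr_gt0// addr_gt0. Qed.

Lemma grid_step_total N : N.+1%:R * grid_step N = K + K.
Proof. by rewrite mulrC divfK// pnatr_eq0. Qed.

Lemma cvg_grid_step : grid_step N @[N --> \oo] --> 0.
Proof. by rewrite -(mulr0 (K + K)); apply: cvgM; [exact: cvg_cst|exact: cvg_harmonic]. Qed.

Lemma grid_content_prod N (Q : 'I_k -> pred 'I_N.+1) :
  grid_content [pred g : {ffun 'I_k -> 'I_N.+1} | [forall i, Q i (g i)]] =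
  \prod_i \sum_(m | Q i m) grid_step N.
Proof.
rewrite bigA_distr_big_dep; apply: eq_big => [g|g _].
  by apply/forallP/familyP => h i; have := h i.
by rewrite prodr_const card_ord.
Qed.

Lemma grid_content_le N (B B' : pred {ffun 'I_k -> 'I_N.+1}) :
  (forall g, B g -> B' g) -> grid_content B <= grid_content B'.
Proof.
move=> BB'; rewrite /grid_content [leLHS]big_mkcond [leRHS]big_mkcond/=.
apply: ler_sum => g _; have := BB' g; case: (B g) => [-> //|_].
by case: ifP => // _; rewrite exprn_ge0// ltW// grid_step_gt0.
Qed.

Lemma grid_coord_open_count N (l u : R) : - K <= l -> u <= K ->
  u - l - grid_step N <=
  \sum_(m < N.+1 | l < grid_coord N m < u) grid_step N.
Proof.
move=> lK uK; apply: grid_count_ge => //; first exact: grid_step_gt0.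
by rewrite grid_step_total; lra.
Qed.

Lemma grid_coord_closed_count N (l u : R) : l <= u ->
  \sum_(m < N.+1 | l <= grid_coord N m <= u) grid_step N
  <= u - l + grid_step N.
Proof. by move=> lu; apply: grid_count_le => //; exact: grid_step_gt0. Qed.

Lemma grid_coord_open_closed N (l u : R) :
  \sum_(m < N.+1 | l < grid_coord N m < u) grid_step N <=
  \sum_(m < N.+1 | l <= grid_coord N m <= u) grid_step N.
Proof.
rewrite [leLHS]big_mkcond [leRHS]big_mkcond/=; apply: ler_sum => m _.
case: ifP => [/andP[/ltW -> /ltW ->]//|_].
by case: ifP => // _; rewrite ltW// grid_step_gt0.
Qed.

(** For a box the content is a product of one-dimensional counts, each of which
    differs from the side length by at most one step.  Any selection between the
    open and the closed box is squeezed to the same limit. *)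
Lemma cvg_grid_content (l u : 'rV[R]_k)
    (B : forall N, pred {ffun 'I_k -> 'I_N.+1}) :
  (forall i, [/\ - K <= l 0 i, l 0 i <= u 0 i & u 0 i <= K]) ->
  (forall N g, open_box l u (grid_pt g) -> B N g) ->
  (forall N g, B N g -> closed_box l u (grid_pt g)) ->
  grid_content (B N) @[N --> \oo] --> box_volume l u.
Proof.
move=> luK oB Bc.
pose o i N := \sum_(m < N.+1 | l 0 i < grid_coord N m < u 0 i) grid_step N.
pose c i N := \sum_(m < N.+1 | l 0 i <= grid_coord N m <= u 0 i) grid_step N.
have side (s : 'I_k -> nat -> R) : (forall i N, u 0 i - l 0 i - grid_step N <= s i N
    <= u 0 i - l 0 i + grid_step N) ->
    \prod_i s i N @[N --> \oo] --> box_volume l u.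
  move=> sb; apply: cvg_big => [|i _]; first exact: mul_continuous.
  apply: (@squeeze_cvgr _ _ _ _ (fun N => u 0 i - l 0 i - grid_step N)
    (fun N => u 0 i - l 0 i + grid_step N)).
  - by apply: nearW => N; exact: sb.
  - by rewrite -[X in _ --> X]subr0; apply: cvgB; [exact: cvg_cst|exact: cvg_grid_step].
  - by rewrite -[X in _ --> X]addr0; apply: cvgD; [exact: cvg_cst|exact: cvg_grid_step].
apply: (@squeeze_cvgr _ _ _ _ (fun N => \prod_i o i N) (fun N => \prod_i c i N)).
- apply: nearW => N; rewrite -!grid_content_prod; apply/andP; split.
    apply: grid_content_le => g /forallP/= go; apply: oB => i.
    by rewrite mxE; exact: go.
  apply: grid_content_le => g /Bc/= gc; apply/forallP => i.
  by have := gc i; rewrite mxE.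
- apply: side => i N; have [? ? ?] := luK i.
  by rewrite grid_coord_open_count//= (le_trans (grid_coord_open_closed _ _ _))//
    grid_coord_closed_count.
- apply: side => i N; have [? ? ?] := luK i.
  by rewrite grid_coord_closed_count// andbT (le_trans (grid_coord_open_count _ _ _))//
    grid_coord_open_closed.
Qed.

Definition set_coord (N : nat) (i : 'I_k) (g : {ffun 'I_k -> 'I_N.+1}) (m : 'I_N.+1) :
    {ffun 'I_k -> 'I_N.+1} := [ffun j => if j == i then m else g j].

(** Averaging over the [i]-th coordinate: if every line of the grid parallel to the
    [i]-th axis meets [B] in content at most [b], then [B] has content at most
    [b] times the volume of a face of the cube. *)
Lemma grid_content_fubini N (i : 'I_k) (B : pred {ffun 'I_k -> 'I_N.+1}) (b : R) :
  (forall g, \sum_(m | B (set_coord i g m)) grid_step N <= b) ->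
  grid_content B <= b * ((K + K) ^+ k / (K + K)).
Proof.
move=> Bb; set h := grid_step N.
have h0 : 0 < h := grid_step_gt0 N.
(* The exchange of the i-th coordinate of g with m is an involution of the pairs
   (g, m), so summing over set_coord i g m counts each point N.+1 times. *)
pose swap (p : {ffun 'I_k -> 'I_N.+1} * 'I_N.+1) := (set_coord i p.1 p.2, p.1 i).
have swapK : involutive swap.
  move=> [g m]; rewrite /swap/= !ffunE eqxx; congr (_, _).
  by apply/ffunP => j; rewrite !ffunE; case: eqP => // ->.
have avg : grid_content B * (K + K) =
    \sum_g h ^+ k * \sum_(m | B (set_coord i g m)) h.
  transitivity (\sum_(p : {ffun 'I_k -> 'I_N.+1} * 'I_N.+1 | B p.1 && true) h ^+ k * h).
    rewrite -[RHS](pair_big_dep B (fun _ _ => true) (fun _ _ => h ^+ k * h))/=.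
    rewrite /grid_content mulr_suml; apply: eq_bigr => g _.
    by rewrite -mulr_sumr sumr_const card_ord -mulr_natl grid_step_total.
  rewrite (reindex_inj (inv_inj swapK))/=.
  under eq_bigl do rewrite andbT.
  rewrite -[LHS](pair_big_dep xpredT (fun g m => B (set_coord i g m))
    (fun _ _ => h ^+ k * h))/=.
  by apply: eq_bigr => g _; rewrite mulr_sumr.
have KK : 0 < K + K by rewrite addr_gt0.
rewrite mulrA ler_pdivlMr// avg -(grid_step_total N).
apply: (@le_trans _ _ (\sum_(g : {ffun 'I_k -> 'I_N.+1}) h ^+ k * b)).
  by apply: ler_sum => g _; apply: ler_wpM2l; rewrite ?exprn_ge0// ltW.
rewrite sumr_const card_ffun !card_ord -[leLHS]mulr_natl natrX -/h [in leRHS]exprMn.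
by rewrite mulrA mulrC.
Qed.

Lemma dot_coord (v x : 'rV[R]_k) i :
  dot v x = v 0 i * x 0 i + \sum_(j | j != i) v 0 j * x 0 j.
Proof. by rewrite /dot (bigD1 i). Qed.

(** Since [v 0 i != 0], each line parallel to the [i]-th axis meets the slab in an
    interval of length at most [2 r / |v 0 i|]. *)
Lemma grid_content_slab N (v : 'rV[R]_k) (c r : R) (i : 'I_k) : v 0 i != 0 -> 0 <= r ->
  grid_content [pred g : {ffun 'I_k -> 'I_N.+1} | `|dot v (grid_pt g) - c| <= r] <=
  ((r + r) / `|v 0 i| + grid_step N) * ((K + K) ^+ k / (K + K)).
Proof.
move=> vi r0; apply: (@grid_content_fubini _ i) => g /=.
pose z := (c - \sum_(j | j != i) v 0 j * grid_coord N (g j)) / v 0 i.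
have vi0 : 0 < `|v 0 i| by rewrite normr_gt0.
have -> : (r + r) / `|v 0 i| = (z + r / `|v 0 i|) - (z - r / `|v 0 i|).
  by rewrite mulrDl; lra.
under eq_bigl => m.
  rewrite (dot_coord _ _ i) !mxE ffunE eqxx.
  have -> : \sum_(j | j != i) v 0 j * grid_pt (set_coord i g m) 0 j =
            \sum_(j | j != i) v 0 j * grid_coord N (g j).
    by apply: eq_bigr => j /negPf ji; rewrite !mxE ffunE ji.
  rewrite -addrA -opprB.
  have -> : v 0 i * grid_coord N m - (c - \sum_(j | j != i) v 0 j * grid_coord N (g j))
       = v 0 i * (grid_coord N m - z).
    by rewrite mulrBr /z [X in _ = _ - X]mulrC divfK.
  rewrite normrM -ler_pdivlMl// [_^-1 * r]mulrC ler_distl.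
  over.
apply: grid_coord_closed_count; rewrite lerD2l ge0_cp// ?divr_ge0//.
Qed.

End Grid.

(** * Comparing Riemann sums with grid sums *)

(** Both open and closed half spaces satisfy this weak form: leaving an
    intersection of half spaces means crossing one of the bounding hyperplanes. *)
Definition separated_by (R : realType) (k q : nat) (v : 'I_q -> 'rV[R]_k) (c : 'I_q -> R)
    (P : set 'rV[R]_k) : Prop :=
  forall x y, P x -> ~ P y -> exists j, dot (v j) x <= c j <= dot (v j) y.

Section RiemannChains.
Variables (R : realType) (n k : nat).
Variables (o : 'rV[R]_n) (F : 'M[R]_(k, n)) (a : kvector R n k) (P : set 'rV[R]_k).
Variables (q : nat) (v : 'I_q -> 'rV[R]_k) (c : 'I_q -> R).
Hypothesis v_neq0 : forall j, v j != 0.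
Hypothesis sepP : separated_by v c P.

Local Notation chain := (dirac_chain R n k).

Definition norm1 (m : nat) (x : 'rV[R]_m) : R := \sum_i `|x 0 i|.

Lemma norm1_ge0 m (x : 'rV[R]_m) : 0 <= norm1 x.
Proof. by apply: sumr_ge0 => i _. Qed.

Lemma enorm_le_norm1 m (x : 'rV[R]_m) : enorm x <= norm1 x.
Proof.
rewrite /enorm -[leRHS]ger0_norm ?norm1_ge0// -sqrtr_sqr ler_wsqrtr//.
rewrite expr2 {1}/norm1 mulr_suml; apply: ler_sum => i _.
rewrite (le_trans (ler_norm _))// normrM ler_wpM2l//.
by rewrite /norm1 (bigD1 i)//= lerDl sumr_ge0.
Qed.

Lemma dot_le_norm1 (x y : 'rV[R]_k) (d : R) :
  (forall i, `|y 0 i| <= d) -> `|dot x y| <= norm1 x * d.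
Proof.
move=> yd; rewrite /norm1 mulr_suml (le_trans (ler_norm_sum _ _ _))//.
by apply: ler_sum => i _; rewrite normrM ler_wpM2l.
Qed.

Definition frame_norm : R := \sum_j norm1 (row j F).

Lemma enorm_mulmx_le (x : 'rV[R]_k) (d : R) :
  (forall i, `|x 0 i| <= d) -> enorm (x *m F) <= frame_norm * d.
Proof.
move=> xd; apply: le_trans (enorm_le_norm1 _) _.
rewrite /frame_norm /norm1 exchange_big/= mulr_suml; apply: ler_sum => i _.
rewrite mxE mulr_suml (le_trans (ler_norm_sum _ _ _))//.
by apply: ler_sum => j _; rewrite normrM mxE mulrC ler_wpM2l.
Qed.

Lemma dotBr (x y z : 'rV[R]_k) : dot x (y - z) = dot x y - dot x z.
Proof. by rewrite /dot -sumrB; apply: eq_bigr => i _; rewrite !mxE mulrBr. Qed.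

(** The integrand of the cell as a function with values in Dirac chains; all forms
    are integrated at once by taking its Riemann sums. *)
Definition pulled_dirac (x : 'rV[R]_k) : chain :=
  (x \in P)%:R *: dirac (o + x *m F) a.

Lemma B1norm_pulled_dirac x : B1norm (pulled_dirac x) <= mass a.
Proof.
rewrite B1normZ normr_nat; apply: le_trans (B1norm_dirac (o + x *m F) a).
by case: (x \in P); rewrite ?mul1r// mul0r B1norm_ge0.
Qed.

(** The points that are within distance [d] of the [j]-th hyperplane in the
    sup norm all lie in this slab. *)
Definition slab (j : 'I_q) (d : R) (y : 'rV[R]_k) : bool :=
  `|dot (v j) y - c j| <= norm1 (v j) * d.

Lemma slab_near (x y z : 'rV[R]_k) d : (forall i, `|x 0 i - y 0 i| <= d) ->
  z = x \/ z = y -> P x -> ~ P y -> exists j, slab j d z.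
Proof.
move=> xyd zxy Px Py; have [j /andP[xj jy]] := sepP Px Py; exists j.
have := @dot_le_norm1 (v j) (x - y) d; rewrite dotBr /slab => h.
have {}h : `|dot (v j) x - dot (v j) y| <= norm1 (v j) * d.
  by apply: h => i; rewrite !mxE.
move: h; rewrite !ler_norml => /andP[h1 h2].
by case: zxy => ->; apply/andP; split; lra.
Qed.

(** Two nearby points of [P] give a translation difference, whose cost is
    proportional to the distance.  If only one of the two lies in [P], the difference is a single
    Dirac term, which costs the full mass; but then both points are close to one
    of the hyperplanes. *)
Lemma B1norm_pulled_diracB (x y : 'rV[R]_k) d : 0 <= d -> (forall i, `|x 0 i - y 0 i| <= d) ->
  B1norm (pulled_dirac x - pulled_dirac y) <=
  (frame_norm * d + \sum_j (slab j d y)%:R) * mass a.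
Proof.
move=> d0 xyd; have m0 := mass_ge0 a.
have S0 : 0 <= \sum_j (slab j d y)%:R :> R by apply: sumr_ge0.
have F0 : 0 <= frame_norm * d.
  by rewrite mulr_ge0// sumr_ge0// => j _; exact: norm1_ge0.
have yxd i : `|y 0 i - x 0 i| <= d by rewrite distrC.
have slabS j : slab j d y -> mass a <=
    (frame_norm * d + \sum_j (slab j d y)%:R) * mass a.
  move=> jy; rewrite -[leLHS]mul1r ler_wpM2r// (bigD1 j)//= jy addrCA lerDl.
  by rewrite addr_ge0// sumr_ge0.
rewrite /pulled_dirac; have [xP|xP] := boolP (x \in P); have [yP|yP] := boolP (y \in P).
- rewrite !scale1r.
  have -> : dirac (o + x *m F) a - dirac (o + y *m F) a
      = translate_diff ((x - y) *m F) (o + y *m F) a.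
    by rewrite /translate_diff -[_ + y *m F + _]addrA mulmxBl [y *m F + _]addrC subrK.
  rewrite (le_trans (B1norm_translate_diff _ _ _))// ler_wpM2r//.
  rewrite (@le_trans _ _ (frame_norm * d)) ?lerDl//.
  by apply: enorm_mulmx_le => i; rewrite !mxE.
- rewrite scale0r subr0 scale1r (le_trans (B1norm_dirac _ _))//.
  rewrite in_setE in xP; rewrite notin_setE in yP.
  by have [j /slabS] := slab_near xyd (or_intror erefl) xP yP.
- rewrite scale0r sub0r scale1r B1normN (le_trans (B1norm_dirac _ _))//.
  rewrite in_setE in yP; rewrite notin_setE in xP.
  by have [j /slabS] := slab_near yxd (or_introl erefl) yP xP.
- by rewrite !scale0r subrr B1norm0 mulr_ge0// addr_ge0.
Qed.

Definition riemann_chain m (l u t : 'I_m -> 'rV[R]_k) : chain :=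
  \sum_j box_volume (l j) (u j) *: pulled_dirac (t j).

Definition grid_chain (K : R) (N : nat) : chain :=
  \sum_(g : {ffun 'I_k -> 'I_N.+1}) grid_step K N ^+ k *: pulled_dirac (grid_pt K g).

Lemma grid_content_slab_uniform (K : R) : 0 < K ->
  exists2 C : R, 0 <= C & forall N d, 0 <= d ->
    \sum_j grid_content K [pred g : {ffun 'I_k -> 'I_N.+1} | slab j d (grid_pt K g)]
      <= C * (d + grid_step K N).
Proof.
move=> K0; pose T := (K + K) ^+ k / (K + K).
have T0 : 0 <= T by rewrite divr_ge0 ?exprn_ge0// addr_ge0// ltW.
have /choice[i vi] : forall j, exists i, v j 0 i != 0.
  by move=> j; apply/rV0Pn/v_neq0.
pose D j := (norm1 (v j) + norm1 (v j)) / `|v j 0 (i j)|.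
have D0 j : 0 <= D j by rewrite divr_ge0// addr_ge0// norm1_ge0.
exists (\sum_j (D j + 1) * T).
  by apply: sumr_ge0 => j _; rewrite mulr_ge0// addr_ge0.
move=> N d d0; rewrite mulr_suml; apply: ler_sum => j _.
have h0 := grid_step_gt0 K0 N.
have nd0 : 0 <= norm1 (v j) * d by rewrite mulr_ge0// norm1_ge0.
apply: le_trans (grid_content_slab K0 N (c j) (vi j) nd0) _.
rewrite -/T [leRHS]mulrAC ler_wpM2r//.
have -> : (norm1 (v j) * d + norm1 (v j) * d) / `|v j 0 (i j)| = D j * d.
  by rewrite /D -mulrDl mulrAC.
rewrite mulrDl mul1r mulrDr; have := mulr_ge0 (D0 j) (ltW h0); lra.
Qed.

(** A point on a common face, or in a degenerate box, may lie in several closed boxes.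
    Preferring the open box that contains the point makes the assignment agree
    with every open box, which is what pins down the content of its fibres. *)
Lemma tagged_partition_assign m (l u : 'I_m -> 'rV[R]_k) (A : set 'rV[R]_k) :
  \bigcup_j closed_box (l j) (u j) = A ->
  trivIset setT (fun j => open_box (l j) (u j)) ->
  exists f : 'rV[R]_k -> option 'I_m,
    [/\ forall x j, open_box (l j) (u j) x -> f x = Some j,
        forall x j, f x = Some j -> closed_box (l j) (u j) x &
        forall x, f x = None -> ~ A x].
Proof.
move=> <- tI.
exists (fun x => if [pick j | `[< open_box (l j) (u j) x >]] is Some j then Some j
                 else [pick j | `[< closed_box (l j) (u j) x >]]).
split=> x.
- move=> j jx; case: pickP => [j' /asboolP j'x|/(_ j)/asboolP//].
  by congr Some; apply: tI => //; exists x.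
- move=> j; case: pickP => [j' /asboolP j'x [<-] i|_].
    by have /andP[/ltW -> /ltW ->] := j'x i.
  by case: pickP => [j' /asboolP j'x [<-]|].
- case: pickP => // _; case: pickP => // h _ [j _ jx].
  by have /asboolP := h j.
Qed.

(** Riemann sums over irregular partitions become comparable once they are all
    compared with the sums over one regular grid.  Replacing the volume of
    each box by the content of the grid points assigned to it has a cost that
    vanishes as the grid is refined, and is part of [e N].  Moving each of these
    points from the tag of its box to itself costs [frame_norm * d] per unit
    volume, plus the content of the slabs of width [O(d)] around the hyperplanes,
    where the membership in [P] may change; that content is [O(d)] up to another part of [e N]. *)
Lemma riemann_chain_grid (K : R) (b b' : 'rV[R]_k) : 0 < K ->
  P `<=` closed_box b b' ->
  (forall x, closed_box b b' x -> forall i, - K <= x 0 i <= K) ->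
  exists2 C : R, 0 <= C & forall d m (l u t : 'I_m -> 'rV[R]_k), 0 < d ->
    tagged_partition b b' d l u t ->
    exists2 e : nat -> R, e N @[N --> \oo] --> (0 : R) &
      forall N, B1norm (riemann_chain l u t - grid_chain K N) <= e N + C * d.
Proof.
move=> K0 Pb bK; have [C C0 slabC] := grid_content_slab_uniform K0.
have m0 := mass_ge0 a.
have F0 : 0 <= frame_norm by apply: sumr_ge0 => j _; exact: norm1_ge0.
exists ((frame_norm * (K + K) ^+ k + C) * mass a).
  by rewrite mulr_ge0// addr_ge0// mulr_ge0// exprn_ge0// addr_ge0// ltW.
move=> d m l u t d0 [lub lutriv tlu lud].
have [f [fo fc fN]] := tagged_partition_assign lub lutriv.
pose cont j N := grid_content K
  [pred g : {ffun 'I_k -> 'I_N.+1} | f (grid_pt K g) == Some j].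
have contE j : cont j N @[N --> \oo] --> box_volume (l j) (u j).
  apply: (@cvg_grid_content R k K K0 _ _ (fun N =>
    [pred g : {ffun 'I_k -> 'I_N.+1} | f (grid_pt K g) == Some j])) => /=.
  - move=> i; have lu i' : l j 0 i' <= u j 0 i'.
      by have /andP[] := tlu j i'; exact: le_trans.
    have lx : closed_box (l j) (u j) (l j) by move=> i'; rewrite lexx lu.
    have ux : closed_box (l j) (u j) (u j) by move=> i'; rewrite lexx lu.
    have sub x : closed_box (l j) (u j) x -> closed_box b b' x.
      by rewrite -lub => jx; exists j.
    have /andP[? ?] := bK _ (sub _ lx) i.
    by have /andP[? ?] := bK _ (sub _ ux) i.
  - by move=> N g /fo ->.
  - by move=> N g /eqP/fc.
pose e1 N := \sum_j `|box_volume (l j) (u j) - cont j N| * mass a.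
exists (fun N => e1 N + C * mass a * grid_step K N).
  rewrite -[X in _ --> X](addr0 0); apply: cvgD; last first.
    by rewrite -(mulr0 (C * mass a)); apply: cvgM; [exact: cvg_cst|exact: cvg_grid_step].
  rewrite [X in _ --> X](_ : 0 = \sum_(j < m) 0 :> R); last by rewrite big1.
  apply: cvg_big => [|j _]; first exact: add_continuous.
  rewrite -(mul0r (mass a)); apply: cvgM; last exact: cvg_cst.
  apply/norm_cvg0P; rewrite -(subrr (box_volume (l j) (u j))).
  by apply: cvgB; [exact: cvg_cst|exact: contE].
move=> N; set h := grid_step K N.
(* The grid chain with every point replaced by the tag of its box; the sum has at
   most one term, and none for points outside the partitioned box. *)
pose tau (g : {ffun 'I_k -> 'I_N.+1}) : chain :=
  \sum_(j | f (grid_pt K g) == Some j) pulled_dirac (t j).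
pose E : chain := \sum_g h ^+ k *: tau g.
have EE : E = \sum_j cont j N *: pulled_dirac (t j).
  rewrite /E /tau; under eq_bigr do rewrite scaler_sumr.
  rewrite (exchange_big_dep xpredT)//=; apply: eq_bigr => j _.
  by rewrite /cont /grid_content scaler_suml; apply: eq_bigl.
apply: le_trans (B1normB _ E _) _; rewrite -addrA lerD//.
  rewrite EE -sumrB; apply: le_trans (B1norm_sum _ _ _) _.
  apply: ler_sum => j _; rewrite -scalerBl B1normZ ler_wpM2l//.
  exact: B1norm_pulled_dirac.
rewrite /E /grid_chain -sumrB; apply: le_trans (B1norm_sum _ _ _) _.
have h0 : 0 <= h ^+ k by rewrite exprn_ge0// ltW// grid_step_gt0.
have tauE g : B1norm (tau g - pulled_dirac (grid_pt K g)) <=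
    (frame_norm * d + \sum_j (slab j d (grid_pt K g))%:R) * mass a.
  rewrite /tau; case fg: (f (grid_pt K g)) => [j|].
    rewrite (big_pred1 j) => [|j']; last by rewrite eq_sym.
    apply: B1norm_pulled_diracB => [|i]; first exact: ltW.
    have /andP[? ?] := fc _ _ fg i; have /andP[? ?] := tlu j i.
    by have := lud j i; rewrite ler_norml => ?; apply/andP; split; lra.
  rewrite big_pred0// sub0r B1normN /pulled_dirac memNset => [|/Pb]; last exact: fN.
  rewrite scale0r B1norm0 mulr_ge0// addr_ge0//; last exact: sumr_ge0.
  by rewrite mulr_ge0// ltW.
apply: (@le_trans _ _ (\sum_(g : {ffun 'I_k -> 'I_N.+1})
    h ^+ k * ((frame_norm * d + \sum_j (slab j d (grid_pt K g))%:R) * mass a))).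
  apply: ler_sum => g _; rewrite -scalerBr B1normZ ger0_norm// ler_wpM2l//.
have -> : \sum_(g : {ffun 'I_k -> 'I_N.+1})
    h ^+ k * ((frame_norm * d + \sum_j (slab j d (grid_pt K g))%:R) * mass a) =
    (frame_norm * d * (K + K) ^+ k + \sum_j grid_content K
      [pred g : {ffun 'I_k -> 'I_N.+1} | slab j d (grid_pt K g)]) * mass a.
  under eq_bigr do rewrite mulrA mulrDr.
  rewrite -mulr_suml big_split/=; congr ((_ + _) * _).
    rewrite -mulr_suml sumr_const card_ffun !card_ord -mulr_natl natrX.
    by rewrite -exprMn grid_step_total mulrC.
  under eq_bigr do rewrite mulr_sumr.
  rewrite exchange_big/=; apply: eq_bigr => j _.
  rewrite /grid_content big_mkcond/= [RHS]big_mkcond/=.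
  by apply: eq_bigr => g _; case: ifP => _; rewrite ?mulr1 ?mulr0.
have := ler_wpM2r m0 (slabC N d (ltW d0)); rewrite -/h; lra.
Qed.

End RiemannChains.

(** * Fine tagged partitions *)

Section Partitions.
Variables (R : realType) (k : nat).

(** The regular subdivision, except that an empty box is tiled by no box at all. *)
Lemma tagged_partition_exists (b b' : 'rV[R]_k) (d : R) : 0 < d ->
  exists m (l u t : 'I_m -> 'rV[R]_k), tagged_partition b b' d l u t.
Proof.
move=> d0; have [bb|/existsNP[i0 bi0]] := pselect (forall i, b 0 i <= b' 0 i); last first.
  exists 0%N, (fun=> 0), (fun=> 0), (fun=> 0); split=> [|[]//|[]//|[]//].
  apply/seteqP; split=> [x [[]]//|x xb]; exfalso; apply: bi0.
  by have /andP[] := xb i0; exact: le_trans.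
pose S := \sum_i (b' 0 i - b 0 i).
have Si i : b' 0 i - b 0 i <= S.
  rewrite /S (bigD1 i)//= lerDl sumr_ge0// => j _.
  by rewrite subr_ge0.
have S0 : 0 <= S by apply: sumr_ge0 => i _; rewrite subr_ge0.
pose N := Num.truncn (S / d).
have NS : S < d * N.+1%:R.
  rewrite mulrC -ltr_pdivrMr//; exact: truncnS_gt.
have N0 : (0 : R) < N.+1%:R by rewrite ltr0n.
pose h i := (b' 0 i - b 0 i) / N.+1%:R.
have h0 i : 0 <= h i by rewrite divr_ge0// subr_ge0.
have hN i : N.+1%:R * h i = b' 0 i - b 0 i.
  by rewrite mulrC divfK// gt_eqF.
pose I := {ffun 'I_k -> 'I_N.+1}.
pose low (g : I) : 'rV[R]_k := \row_i (b 0 i + (g i)%:R * h i).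
pose upp (g : I) : 'rV[R]_k := \row_i (b 0 i + (g i).+1%:R * h i).
have le_lu g i : low g 0 i <= upp g 0 i.
  by rewrite !mxE lerD2l ler_wpM2r// ler_nat.
exists #|I|, (low \o enum_val), (upp \o enum_val), (low \o enum_val).
split=> [||j i|j i] /=.
- apply/seteqP; split=> [x [j _ /= jx] i|x xb].
    have /andP[lx xu] := jx i; apply/andP; split.
      by apply: le_trans lx; rewrite !mxE lerDl mulr_ge0.
    apply: (le_trans xu); rewrite !mxE -lerBrDl -hN ler_wpM2r// ler_nat.
    exact: ltn_ord.
  have /choice[g gP] : forall i, exists m : 'I_N.+1,
      b 0 i + m%:R * h i <= x 0 i <= b 0 i + m.+1%:R * h i.
    move=> i; have /andP[bx xb'] := xb i.
    have [hi0|hi0] := eqVneq (h i) 0.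
      exists ord0; move: (hN i); rewrite hi0 !mulr0 addr0 => /esym/eqP.
      by rewrite subr_eq0 => /eqP b'b; rewrite bx -b'b.
    have hi : 0 < h i by rewrite lt_neqAle eq_sym hi0 h0.
    pose y := (x 0 i - b 0 i) / h i.
    have y0 : 0 <= y by rewrite divr_ge0// subr_ge0.
    have yx : x 0 i = b 0 i + y * h i by rewrite /y divfK// addrC subrK.
    have yN : y <= N.+1%:R.
      by rewrite ler_pdivrMr// hN lerD2r.
    have [tN|Nt] := ltnP (Num.truncn y) N.+1.
      exists (Ordinal tN) => /=; rewrite yx !lerD2l !ler_wpM2r//.
        by rewrite ltW// truncnS_gt.
      by rewrite truncn_le.
    (* x lies on the upper face of the box, which belongs to the last cell. *)
    exists ord_max => /=; rewrite yx !lerD2l !ler_wpM2r//.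
    apply: le_trans (_ : (Num.truncn y)%:R <= _); last by rewrite truncn_le.
    by rewrite ler_nat ltnW.
  pose gf : I := [ffun i => g i].
  exists (enum_rank gf) => //= i.
  by rewrite enum_rankK !mxE ffunE gP.
- move=> j j' _ _ [x [jx j'x]]; apply: enum_val_inj; apply/ffunP => i.
  have /andP[l1 u1] := jx i; have /andP[l2 u2] := j'x i.
  move: l1 u1 l2 u2; rewrite /= !mxE => l1 u1 l2 u2.
  set g := enum_val j in l1 u1 *; set g' := enum_val j' in l2 u2 *.
  have lt1 (p r : nat) : b 0 i + p%:R * h i < x 0 i -> x 0 i < b 0 i + r.+1%:R * h i ->
      (p <= r)%N.
    move=> px xr; rewrite leqNgt; apply/negP => rp.
    have := lt_trans px xr; rewrite ltrD2l ltNge ler_wpM2r//.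
    by rewrite ler_nat.
  by apply/val_inj/eqP; rewrite eqn_leq (lt1 _ _ l1 u2) (lt1 _ _ l2 u1).
- by rewrite lexx le_lu.
- rewrite !mxE -[(enum_val j i).+1]addn1 natrD mulrDl mul1r.
  rewrite addrA [X in X - _]addrC addrK ltr_pdivrMr//.
  exact: le_lt_trans (Si i) NS.
Qed.

End Partitions.

(** * Integration over a cell *)

Section CellChains.
Variables (R : realType) (n k : nat).
Local Notation chain := (dirac_chain R n k).

Lemma affine_cell_separated (P : set 'rV[R]_k) : affine_cell P ->
  exists q (v : 'I_q -> 'rV[R]_k) c, (forall j, v j != 0) /\ separated_by v c P.
Proof.
move=> [_ [q [v [c [v0 PE]]]]]; exists q, v, c; split=> // x y Px nPy.
case: PE => PE; rewrite PE in Px nPy; move/existsNP: nPy => [j /not_implyP[_]];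
  exists j; have := Px j Logic.I => /= xj.
  by rewrite (ltW xj) leNgt; apply/negP.
by rewrite xj ltW// ltNge; apply/negP.
Qed.

Lemma affine_cell_box (P : set 'rV[R]_k) : affine_cell P ->
  exists b b' : 'rV[R]_k, P `<=` closed_box b b'.
Proof.
move=> [/compact_bounded[M [_ MP]] _].
exists (\row__ (- (M + 1))), (\row__ (M + 1)) => x Px i; rewrite !mxE -ler_norml.
apply: le_trans (_ : `|x| <= _); last first.
  by apply: MP; [rewrite ltrDl|exact: subset_closure].
rewrite [leRHS]mx_normrE; exact: (le_bigmax _ (fun ij => `|x ij.1 ij.2|) (0, i)).
Qed.

Lemma tagged_partition_le (b b' : 'rV[R]_k) d d' m (l u t : 'I_m -> 'rV[R]_k) :
  d <= d' -> tagged_partition b b' d l u t -> tagged_partition b b' d' l u t.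
Proof.
by move=> dd' [? ? ? lud]; split=> // j i; exact: lt_le_trans (lud j i) dd'.
Qed.

Variables (o : 'rV[R]_n) (F : 'M[R]_(k, n)) (a : kvector R n k).
Variables (P : set 'rV[R]_k).
Variables (q : nat) (v : 'I_q -> 'rV[R]_k) (c : 'I_q -> R).
Hypothesis v_neq0 : forall j, v j != 0.
Hypothesis sepP : separated_by v c P.

Local Notation chain_of := (riemann_chain o F a P).

(** The Riemann sums form a Cauchy net in the [B1norm], even when the enclosing
    boxes differ: both are compared with the same grid in a cube containing the
    two boxes, and the grid is then refined. *)
Lemma riemann_chain_close (b1 b1' b2 b2' : 'rV[R]_k) :
  P `<=` closed_box b1 b1' -> P `<=` closed_box b2 b2' ->
  exists2 C : R, 0 <= C & forall d m1 (l1 u1 t1 : 'I_m1 -> 'rV[R]_k)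
      m2 (l2 u2 t2 : 'I_m2 -> 'rV[R]_k), 0 < d ->
    tagged_partition b1 b1' d l1 u1 t1 -> tagged_partition b2 b2' d l2 u2 t2 ->
    B1norm (chain_of l1 u1 t1 - chain_of l2 u2 t2) <= C * d.
Proof.
move=> Pb1 Pb2.
pose K := 1 + norm1 b1 + norm1 b1' + norm1 b2 + norm1 b2'.
have n1 := norm1_ge0 b1; have n2 := norm1_ge0 b1'.
have n3 := norm1_ge0 b2; have n4 := norm1_ge0 b2'.
have K0 : 0 < K by rewrite /K; lra.
have le_norm1 (x : 'rV[R]_k) i : - norm1 x <= x 0 i <= norm1 x.
  by rewrite -ler_norml /norm1 (bigD1 i)//= lerDl sumr_ge0.
have box1 x : closed_box b1 b1' x -> forall i, - K <= x 0 i <= K.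
  move=> bx i; have := bx i; have := le_norm1 b1 i; have := le_norm1 b1' i.
  by rewrite /K; lra.
have box2 x : closed_box b2 b2' x -> forall i, - K <= x 0 i <= K.
  move=> bx i; have := bx i; have := le_norm1 b2 i; have := le_norm1 b2' i.
  by rewrite /K; lra.
have [C1 C10 h1] := riemann_chain_grid o F a v_neq0 sepP K0 Pb1 box1.
have [C2 C20 h2] := riemann_chain_grid o F a v_neq0 sepP K0 Pb2 box2.
exists (C1 + C2); first exact: addr_ge0.
move=> d m1 l1 u1 t1 m2 l2 u2 t2 d0 /(h1 _ _ _ _ _ d0)[e1 e10 le1].
move=> /(h2 _ _ _ _ _ d0)[e2 e20 le2].
have lim : e1 N + e2 N + (C1 + C2) * d @[N --> \oo] --> (C1 + C2) * d.
  rewrite -[X in _ --> X]add0r -[X in _ --> X + _](addr0 0).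
  by apply: cvgD; [exact: cvgD|exact: cvg_cst].
apply: (cvgr_to_ge lim); apply: nearW => N.
apply: le_trans (B1normB _ (grid_chain o F a P K N) _) _.
have := le1 N; have := le2 N; rewrite -B1normN opprB; lra.
Qed.

Lemma riemann_chain_eval (w : {scalar chain}) m (l u t : 'I_m -> 'rV[R]_k) :
  w (chain_of l u t) = \sum_j ((fun x => w (dirac (o + x *m F) a)) \_ P) (t j)
    * box_volume (l j) (u j).
Proof.
rewrite linear_sum; apply: eq_bigr => j _; rewrite linearZ/= mulrC; congr (_ * _).
by rewrite /patch linearZ/=; case: ifP; rewrite ?mul1r ?mul0r.
Qed.

(** The enclosing box is part of the existential in [is_riemann_int], so two
    values of the integral may come from different boxes. *)
Lemma riemann_int_unique (w : {scalar chain}) (I I' : R) : bounded_lipschitz w ->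
  is_riemann_int P (fun x => w (dirac (o + x *m F) a)) I ->
  is_riemann_int P (fun x => w (dirac (o + x *m F) a)) I' -> I = I'.
Proof.
move=> /bounded_lipschitz_le[M M0 wM] [b1 [b1' [Pb1 h1]]] [b2 [b2' [Pb2 h2]]].
have [C C0 hC] := riemann_chain_close Pb1 Pb2.
apply/eqP; rewrite -subr_eq0 -normr_le0; apply/ler_addgt0Pl => e e0; rewrite addr0.
have e3 : 0 < e / 3 by rewrite divr_gt0.
have [d1 d10 D1] := h1 _ e3; have [d2 d20 D2] := h2 _ e3.
have MC : 0 < M * C + 1 by rewrite ltr_wpDl// mulr_ge0.
pose d := Num.min (Num.min d1 d2) (e / 3 / (M * C + 1)).
have d0 : 0 < d by rewrite !lt_min d10 d20 divr_gt0.
have [m1 [l1 [u1 [t1 p1]]]] := tagged_partition_exists b1 b1' d0.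
have [m2 [l2 [u2 [t2 p2]]]] := tagged_partition_exists b2 b2' d0.
have E1 : `|w (chain_of l1 u1 t1) - I| < e / 3.
  rewrite riemann_chain_eval; apply: D1; apply: tagged_partition_le p1.
  by rewrite !ge_min lexx.
have E2 : `|w (chain_of l2 u2 t2) - I'| < e / 3.
  rewrite riemann_chain_eval; apply: D2; apply: tagged_partition_le p2.
  by rewrite !ge_min lexx orbT.
have E3 : `|w (chain_of l1 u1 t1) - w (chain_of l2 u2 t2)| <= e / 3.
  rewrite -linearB (le_trans (wM _))//.
  rewrite (@le_trans _ _ (M * (C * d)))// ?ler_wpM2l ?hC//.
  have : (M * C + 1) * d <= e / 3.
    by rewrite mulrC -ler_pdivlMr// ge_min lexx orbT.
  by rewrite mulrA mulrDl; lra.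
move: E1 E2 E3; rewrite !ltr_norml !ler_norml => /andP[? ?] /andP[? ?] /andP[? ?].
by apply/andP; split; lra.
Qed.

(** The Riemann sums of the Dirac-valued integrand along partitions of mesh
    [1 / (N + 1)] converge in the completion.  A bounded Lipschitz form is
    continuous for the norm, so its Riemann sums converge to its value on the limit,
    uniformly over all partitions of the same mesh. *)
Lemma riemann_chain_limit (b b' : 'rV[R]_k) : P `<=` closed_box b b' ->
  exists J : diff_chain R n k, forall w : {scalar chain}, bounded_lipschitz w ->
    is_riemann_int P (fun x => w (dirac (o + x *m F) a)) (chain_int J w).
Proof.
move=> Pb; have [C C0 hC] := riemann_chain_close Pb Pb.
have /choice[A AP] : forall N : nat, exists A : chain, exists m (l u t : 'I_m -> 'rV[R]_k),
    tagged_partition b b' (N.+1%:R^-1) l u t /\ A = chain_of l u t.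
  move=> N; have N0 : (0 : R) < N.+1%:R^-1 by rewrite invr_gt0 ltr0n.
  have [m [l [u [t p]]]] := tagged_partition_exists b b' N0.
  by exists (chain_of l u t), m, l, u, t.
have small d : 0 < d -> exists N0 : nat, forall N, (N0 <= N)%N -> N.+1%:R^-1 <= d :> R.
  move=> d0; exists (Num.truncn d^-1) => N NN.
  rewrite -[d]invrK lef_pV2 ?posrE ?invr_gt0// ?ltr0n//.
  by rewrite (le_trans (ltW (truncnS_gt _)))// ler_nat.
have Aclose d m (l u t : 'I_m -> 'rV[R]_k) N : 0 < d -> tagged_partition b b' d l u t ->
    N.+1%:R^-1 <= d -> B1norm (chain_of l u t - A N) <= C * d.
  move=> d0 p Nd; have [m' [l' [u' [t' [p' ->]]]]] := AP N.
  exact: hC d0 p (tagged_partition_le Nd p').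
have Acauchy : B1_cauchy A.
  move=> e e0; have C1 : 0 < C + 1 by rewrite ltr_wpDl.
  have d0 : 0 < e / (C + 1) by rewrite divr_gt0.
  have [N0 hN0] := small _ d0; exists N0 => i j i0 j0.
  have [m [l [u [t [p ->]]]]] := AP i.
  apply: le_lt_trans (Aclose _ _ _ _ _ _ d0 (tagged_partition_le (hN0 _ i0) p) (hN0 _ j0)) _.
  have : (C + 1) * (e / (C + 1)) = e by rewrite mulrC divfK// gt_eqF.
  by rewrite mulrDl; lra.
pose Ac : cauchy_chain R n k := exist _ A (introT (asboolP _) Acauchy).
exists (\pi_(diff_chain R n k) Ac)%qT => w wBL; exists b, b'; split=> // e e0.
have wlim : w (A i) @[i --> \oo] --> chain_int (\pi_(diff_chain R n k) Ac)%qT w.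
  by apply: chain_int_cvg => //; exists Ac.
have [M M0 wM] := bounded_lipschitz_le wBL.
have MC : 0 < M * C + 1 by rewrite ltr_wpDl// mulr_ge0.
pose d := e / (M * C + 1); have d0 : 0 < d by rewrite divr_gt0.
exists d => // m l u t p; rewrite -riemann_chain_eval.
apply: (@le_lt_trans _ _ (M * (C * d))); last first.
  have : M * C * d + d = e.
    by rewrite -[X in _ + X]mul1r -mulrDl mulrC divfK// gt_eqF.
  by move: (d) d0 => r; lra.
have [N0 hN0] := small _ d0.
apply: (cvgr_to_le (cvg_norm (cvgB (cvg_cst (w (chain_of l u t))) wlim))).
exists N0 => // N /= /hN0 Nd.
rewrite -[X in `|X| <= _]/(w (chain_of l u t) - w (A N)) -linearB (le_trans (wM _))// ler_wpM2l//.
exact: Aclose.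
Qed.

End CellChains.

Theorem proposition2p11p2 (R : realType) (n k : nat) (s : oriented_cell R n k) :
  exists! J : diff_chain R n k,
    forall w : {scalar dirac_chain R n k},
      bounded_lipschitz w -> is_cell_int s w (chain_int J w).
Proof.
have [P Pcell sE] := cell_setP s.
have preE : cell_map s @^-1` s = P.
  rewrite [X in _ @^-1` X]sE; apply/seteqP; split=> [x [y Py]|x Px]; last by exists x.
  by rewrite /cell_map => /addrI/(row_free_inj (cell_frame_free s)) <-.
have [q [v [c [v0 sepP]]]] := affine_cell_separated Pcell.
have [b [b' Pb]] := affine_cell_box Pcell.
have [J JP] := riemann_chain_limit (cell_pt s) (cell_frame s) (cell_kvector s) v0 sepP Pb.
exists J; split=> [w wBL|J' J'P]; first by rewrite /is_cell_int preE; exact: JP.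
apply: diff_chain_separated => w wBL.
apply: (riemann_int_unique v0 sepP wBL (JP w wBL)).
by have := J'P w wBL; rewrite /is_cell_int preE.
Qed.
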